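(* Let $w$ be a super-polynomially decreasing weight. Then there exists a sequence $(r_n)_{n\ge1}$ in $(0,1)$ with $r_n\to1$ such that for every $p\in[1,\infty)$, $$\frac{\mathcal{C}_{n,r_n}(L_a^p(w))}{n}=o\left(\frac{1}{1-r_n}\right),\qquad n\to\infty.$$
   Context: $\mathbb{D}=\{z\in\mathbb{C}:|z|<1\}$, $\mathbb{T}=\{z\in\mathbb{C}:|z|=1\}$, $m$ is the normalized Lebesgue measure on $\mathbb{T}$, and $\mathrm{Hol}(\mathbb{D})$ is the space of holomorphic functions on $\mathbb{D}$. $\mathcal{P}_n$ is the space of complex polynomials of degree at most $n$. For an integer $n\ge1$ and $r\in(0,1)$, $\mathcal{R}_{n,r}$ is the set of rational functions $p/q$ with $p,q\in\mathcal{P}_n$, $\deg p<\deg q$, and $q(\zeta)\ne0$ for $|\zeta|<1/r$. A weight is a function $w\ge0$ on $(0,1)$ with $\int_0^1 w(\rho)\,d\rho<\infty$. For $1\le p<\infty$, the radial weighted Bergman space $L_a^p(w)$ is the set of $f\in\mathrm{Hol}(\mathbb{D})$ with $$\|f\|_{L_a^p(w)}^p=\int_0^1\rho\, w(\rho)\int_{\mathbb{T}}|f(\rho\zeta)|^p\,dm(\zeta)\,d\rho<\infty.$$ The weight $w$ is super-polynomially decreasing if for every $\gamma>0$ there exists $r(\gamma)\in(0,1)$ such that the function $\rho\mapsto(1-\rho)^{-\gamma}w(\rho)$ decreases on $[r(\gamma),1)$. For a space $X$ of holomorphic functions in $\mathbb{D}$ with norm $\|\cdot\|_X$, $\mathcal{C}_{n,r}(X)$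 denotes the best (smallest) constant such that $\|f'\|_X\le\mathcal{C}_{n,r}(X)\|f\|_X$ for all $f\in\mathcal{R}_{n,r}$. *)

(* Defs.v *)
(* MathComp-Analysis, over an abstract [R : realType]; the complex plane is
   [R[i]] from mathcomp-real-closed, seen as a normed module over itself
   ([R[i]^o]) for complex differentiation. *)
From HB Require Import structures.
From mathcomp Require Import all_boot all_order all_algebra.
From mathcomp Require Import all_classical all_reals all_analysis.
From mathcomp Require Import complex.

Set Implicit Arguments.
Unset Strict Implicit.
Unset Printing Implicit Defensive.

Import Order.TTheory GRing.Theory Num.Theory.
Import numFieldNormedType.Exports.
Import ComplexField.Normc.

Local Open Scope classical_set_scope.
Local Open Scope complex_scope.
Local Open Scope ring_scope.

(* The completed Lebesgue measure is used so that [w] may be an arbitrary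
   Lebesgue measurable function, not only a Borel one.  Values of [w] outside
   (0, 1) are irrelevant. *)
Definition is_weight (R : realType) (w : R -> R) : Prop :=
  (forall rho : R, 0 < rho < 1 -> 0 <= w rho) /\
  (@completed_lebesgue_measure R).-integrable `]0, 1[ (EFin \o w).

(* "Decreasing" is non-strict: weights vanishing near 1 are allowed. *)
Definition super_polynomially_decreasing (R : realType) (w : R -> R) : Prop :=
  forall gamma : R, 0 < gamma -> exists2 r : R, 0 < r < 1 &
    {in `[r, 1[ &, {homo (fun rho => (1 - rho) `^ (- gamma) * w rho) :
                      x y /~ x <= y}}.

(* Integration on the unit circle against its normalized Lebesgue measure [m],
   the image of [d theta / (2 pi)] on [0, 2 pi] under
   [theta |-> cos theta + i sin theta]. *)
Definition circle_integral (R : realType) (g : R[i] -> \bar R) : \bar R :=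
  (((2 * pi)^-1)%:E *
   \int[@lebesgue_measure R]_(theta in `[0%R, (2 * pi)%R])
      g (cos theta +i* sin theta))%E.

(* Norm of the radial weighted Bergman space L_a^p(w); it is [+oo] on
   holomorphic functions outside the space and only depends on the values of
   [f] in the open unit disc. *)
Definition bergman_norm (R : realType) (p : R) (w : R -> R) (f : R[i] -> R[i]) :
    \bar R :=
  ((\int[@completed_lebesgue_measure R]_(rho in `]0%R, 1%R[)
      ((rho * w rho)%:E *
       circle_integral (fun zeta => (normc (f (rho%:C * zeta)) `^ p)%:E)))
   `^ p^-1)%E.

(* [size] is the degree plus one, and [size 0 = 0], so the zero function
   belongs to the class. *)
Definition rational_class (R : realType) (n : nat) (r : R) :
    set (R[i] -> R[i]) :=
  [set f | exists p q : {poly R[i]},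
     [/\ (size p <= n.+1)%N, (size q <= n.+1)%N, (size p < size q)%N,
         (forall zeta : R[i], normc zeta < r^-1 -> q.[zeta] != 0) &
         f = (fun z => p.[z] / q.[z])]].

Definition complex_derivative (R : realType) (f : R[i] -> R[i]) :
    R[i] -> R[i] :=
  derive1 (f : R[i]^o -> R[i]^o).

(* C_{n,r}(X) for a space X with norm [N]; it is [+oo] when no constant is
   admissible.  The constraint [0 <= c] only matters when [N] vanishes on the
   whole class, e.g. for the zero weight. *)
Definition best_constant (R : realType) (n : nat) (r : R)
    (N : (R[i] -> R[i]) -> \bar R) : \bar R :=
  ereal_inf [set c%:E | c in [set c : R | 0 <= c /\
    forall f, rational_class n r f ->
      (N (complex_derivative f) <= c%:E * N f)%E]].

(* Main.v *)
(* The sequence [r_n] may tend to 1 as fast as we like, so all constants may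
   depend on [n]; it suffices that [C_(n, 1 - d) <= 3 / d] for [1 <= p <= n]
   once [d] is small enough.  Write [M(s)] for the p-th power mean of [f] on the
   circle of radius [s], and [M'(rho)] for that of [f'].

   Since [f] has at most [n] poles, at distance at least [d] from [rho zeta], its
   denominator is essentially constant at scale [d], and interpolating the
   numerator at [n] points of modulus [s] gives [M'(rho) <= (A / d)^p M(s)] as
   soon as [|rho - s| <= L d], with [A] depending on [n], [L] and a lower bound
   on [s] only.  Rotation invariance of the circle average turns the [n] points
   into one radius.

   The radii are split into three ranges.  For [rho < a], compare with all
   [s >= a]: the constant does not depend on [d].  For
   [a <= rho < 1 - B d], take [s = rho] at scale [B d]: the constant is
   [A / (B d) <= 1 / d] if [B] is chosen equal to [A].  For [rho >= 1 - B d],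
   compare with [s] in [1 - 3 B d, 1 - 2 B d): the rational function changes by a
   factor depending on [n] only, while [w(rho) <= 2^-gamma w(s)] with [gamma]
   arbitrary, and a large [gamma] absorbs that factor. *)
Require Import Defs.
From HB Require Import structures.
From mathcomp Require Import all_boot all_order all_algebra.
From mathcomp Require Import all_classical all_reals all_analysis.
From mathcomp Require Import measurable_realfun.
From mathcomp Require Import complex ring lra.

Set Implicit Arguments.
Unset Strict Implicit.
Unset Printing Implicit Defensive.

Import Order.TTheory GRing.Theory Num.Theory.
Import numFieldNormedType.Exports.
Import ComplexField.Normc.

Local Open Scope classical_set_scope.
Local Open Scope ring_scope.

(** * The modulus of a complex number *)

Section Normc.
Variable R : rcfType.
Implicit Types x y z : R[i].

Lemma normc_ge0 x : 0 <= normc x.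
Proof. by case: x => a b; rewrite sqrtr_ge0. Qed.

Lemma ler_normcD x y : normc (x + y) <= normc x + normc y.
Proof. by rewrite -lecR rmorphD; exact: ComplexField.lec_normD. Qed.

Lemma normcNE x : normc (- x) = normc x.
Proof. by case: x => a b /=; rewrite !sqrrN. Qed.

Lemma ler_normcB x y : normc (x - y) <= normc x + normc y.
Proof. by rewrite (le_trans (ler_normcD _ _))// normcNE. Qed.

Lemma normcBC x y : normc (x - y) = normc (y - x).
Proof. by rewrite -normcNE opprB. Qed.

Lemma normc_gt0 x : (0 < normc x) = (x != 0).
Proof.
rewrite lt_def normc_ge0 andbT; congr negb.
by apply/eqP/eqP => [/eq0_normc//|->]; rewrite normc0.
Qed.

Lemma normcX x n : normc (x ^+ n) = normc x ^+ n.
Proof.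
by elim: n => [|n ih]; rewrite ?expr0 ?normc1// !exprS normcM ih.
Qed.

Lemma normc_real (k : R) : normc k%:C%C = `|k|.
Proof. by rewrite /= expr0n addr0 sqrtr_sqr. Qed.

End Normc.

(** * Polynomial interpolation and variation of a polynomial away from its roots *)

Section Interpolation.
Variable R : rcfType.
Implicit Types (p q : {poly R[i]}) (x z : R[i]).

(* Induction on the nodes, through the divided difference
   [(p - p.[x]) / ('X - x)], which is bounded by [2 m / e] at the other nodes. *)
Lemma poly_interpolation_bound (xs : seq R[i]) z (e D : R) : 0 < e -> e <= D ->
  (forall x, x \in xs -> normc (z - x) <= D) ->
  pairwise (fun x y => e <= normc (x - y)) xs ->
  forall p (m : R), 0 <= m -> (size p <= size xs)%N ->
  (forall x, x \in xs -> normc p.[x] <= m) ->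
  normc p.[z] <= (3 * (D / e)) ^+ size xs * m /\
  normc p^`().[z] <= (size xs)%:R * (3 * (D / e)) ^+ size xs * (m / e).
Proof.
move=> e0 eD; set t := D / e.
have t1 : 1 <= t by rewrite ler_pdivlMr// mul1r.
elim: xs => [|x xs ih] zx sep p m m0 szp pm.
  move: szp; rewrite leqn0 size_poly_eq0 => /eqP ->.
  by rewrite deriv0 !horner0 normc0 mul0r expr0 !mul1r mul0r.
have /factor_theorem[q pq] : root (p - p.[x]%:P) x.
  by rewrite /root !hornerE subrr.
have {}pq : p = q * ('X - x%:P) + p.[x]%:P by rewrite -pq subrK.
set c := p.[x] in pq *.
have szq : (size q <= size xs)%N.
  have [->|q0] := eqVneq q 0; first by rewrite size_poly0.
  have : (size (q * ('X - x%:P))%R <= (size xs).+1)%N.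
    have -> : q * ('X - x%:P) = p - c%:P by rewrite pq addrK.
    rewrite (leq_trans (size_polyD _ _))// geq_max szp size_polyN.
    by rewrite (leq_trans (size_polyC_leq1 _)).
  by rewrite size_Mmonic ?monicXsubC// size_XsubC addn2.
have zxD : normc (z - x) <= D by rewrite zx// mem_head.
have cm : normc c <= m by rewrite pm// mem_head.
move: sep => /= /andP[sepx sepxs].
have qm y : y \in xs -> normc q.[y] <= 2 * (m / e).
  move=> yxs.
  have exy : e <= normc (y - x) by rewrite normcBC; exact: (allP sepx).
  have : normc (q.[y] * (y - x)) <= 2 * m.
    have -> : q.[y] * (y - x) = p.[y] - c.
      by rewrite [in RHS]pq !hornerE addrK.
    apply: le_trans (ler_normcB _ _) _.
    by rewrite mulr_natl mulr2n lerD// pm// in_cons yxs orbT.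
  rewrite normcM mulrA ler_pdivlMr//; apply: le_trans.
  by rewrite ler_wpM2l// normc_ge0.
have m1 : 0 <= m / e by rewrite divr_ge0// ltW.
have [||qz q'z] := ih _ sepxs q (2 * (m / e)) _ szq qm.
- by move=> y yxs; rewrite zx// in_cons yxs orbT.
- by rewrite mulr_ge0.
have T1 : 1 <= (3 * t) ^+ size xs by apply: exprn_ege1; lra.
set T := _ ^+ size xs in qz q'z T1.
set k := (size xs)%:R in q'z.
have k0 : 0 <= k :> R by rewrite ler0n.
have De : D = t * e by rewrite /t divfK// gt_eqF.
have mE : m = (m / e) * e by rewrite divfK// gt_eqF.
set u := m / e in m1 qz q'z mE.
have D0 : 0 <= D by rewrite (le_trans (ltW e0)).
have TX : (3 * t) ^+ (size (x :: xs)) = 3 * t * T by rewrite /= exprS.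
have p'z : p^`().[z] = q^`().[z] * (z - x) + q.[z].
  by rewrite [in p^`()]pq derivD derivM derivXsubC derivC !hornerE.
have pz : p.[z] = q.[z] * (z - x) + c by rewrite [in LHS]pq !hornerE.
have kS : (size (x :: xs))%:R = k + 1 :> R by rewrite natr1.
(* For the value, [2 * t] out of [3 * t] pays for [q.[z] * (z - x)] and the remaining [t] for the
   constant [c]. For the derivative, the extra term [q.[z]] is paid for by the increment of the
   number of nodes. *)
rewrite p'z pz TX kS -/u; split.
- apply: le_trans (ler_normcD _ _) _; rewrite normcM.
  have : normc q.[z] * normc (z - x) <= T * (2 * u) * D.
    by rewrite ler_pM ?normc_ge0.
  have uT : u * e <= t * T * (u * e).
    by apply: ler_peMl; [rewrite mulr_ge0// ltW|exact: mulr_ege1].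
  have -> : T * (2 * u) * D = 2 * (t * T * (u * e)) by rewrite De; ring.
  have -> : 3 * t * T * m = 3 * (t * T * (u * e)) by rewrite mE; ring.
  move: cm; rewrite mE; lra.
- have : normc q^`().[z] * normc (z - x) <= k * T * (2 * u / e) * D.
    by rewrite ler_pM ?normc_ge0.
  have -> : k * T * (2 * u / e) * D = 2 * (k * (t * T * u)).
    by rewrite /t; ring.
  move=> h; have uT : T * u <= t * T * u.
    rewrite ler_wpM2r//; apply: ler_peMl => //.
    exact: le_trans ler01 T1.
  have t0 := le_trans ler01 t1; have T0 := le_trans ler01 T1.
  have tTu : 0 <= t * T * u by exact: mulr_ge0 (mulr_ge0 t0 T0) m1.
  have kuT : 0 <= k * (t * T * u).
    exact: mulr_ge0 k0 tTu.
  have -> : (k + 1) * (3 * t * T) * u = 3 * (k * (t * T * u)) + 3 * (t * T * u).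
    by ring.
  apply: le_trans (ler_normcD _ _) _.
  rewrite normcM; lra.
Qed.

(** Each root [y] satisfies |x - y| <= |x - z| + |z - y| <= (1 + |x - z| / d) |z - y|. The
    logarithmic derivative at [z] is a sum of terms 1 / (z - y), each of modulus at most 1 / d. *)
Lemma prod_XsubC_ratio (rs : seq R[i]) z (d : R) : 0 < d ->
  (forall y, y \in rs -> d <= normc (z - y)) ->
  let q := \prod_(y <- rs) ('X - y%:P) in
  (forall x, normc q.[x] <= (1 + normc (x - z) / d) ^+ size rs * normc q.[z]) /\
  normc q^`().[z] <= (size rs)%:R / d * normc q.[z].
Proof.
move=> d0; elim: rs => [|y rs ih] dz /=.
  rewrite big_nil; split=> [x|]; first by rewrite !hornerC expr0 mul1r.
  by rewrite -polyC1 derivC horner0 normc0 !mul0r.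
rewrite big_cons; have [|ih1 ih2] := ih.
  by move=> v vrs; rewrite dz// in_cons vrs orbT.
set q := \prod_(_ <- _) _ in ih1 ih2 *.
have dy : d <= normc (z - y) by rewrite dz// mem_head.
split=> [x|].
- rewrite !hornerE !normcM exprS mulrACA ler_pM ?normc_ge0//.
  have -> : x - y = (x - z) + (z - y) by ring.
  apply: le_trans (ler_normcD _ _) _.
  rewrite mulrDl mul1r addrC lerD2l -mulrA ler_peMr ?normc_ge0//.
  by rewrite mulrC ler_pdivlMr// mul1r.
- rewrite derivM derivXsubC !hornerE.
  apply: le_trans (ler_normcD _ _) _.
  rewrite !normcM -natr1 !mulrDl mul1r addrC; apply: lerD.
    rewrite mulrCA ler_wpM2l ?normc_ge0//.
  rewrite mulrA ler_peMl ?normc_ge0//.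
  by rewrite mulrC ler_pdivlMr// mul1r.
Qed.

End Interpolation.

(** * Pointwise bound for the derivative of a rational function *)

Section RationalBound.
Variable R : rcfType.
Implicit Types (p q : {poly R[i]}) (x z : R[i]).

(** The rational parametrization of the unit circle avoids trigonometry, so that this part works
    over any real closed field. On [-1, 1] it distorts distances by a factor between 1 and 2. *)
Definition cayley (t : R) : R[i] := (1 +i* t)%C / (1 -i* t)%C.

Lemma normc_1i (t : R) : normc (1 +i* t)%C = Num.sqrt (1 + t ^+ 2).
Proof. by rewrite /= expr1n. Qed.

Lemma normc_1Ni (t : R) : normc (1 -i* t)%C = Num.sqrt (1 + t ^+ 2).
Proof. by rewrite /= expr1n sqrrN. Qed.

Let sqrt_ge1 (t : R) : 1 <= Num.sqrt (1 + t ^+ 2).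
Proof. by rewrite -[leLHS]sqrtr1 ler_wsqrtr// lerDl sqr_ge0. Qed.

Let neq0_1Ni (t : R) : (1 -i* t)%C != 0 :> R[i].
Proof. by rewrite eq_complex /= oner_eq0. Qed.

Lemma normc_cayley t : normc (cayley t) = 1.
Proof.
rewrite normcM normcV normc_1i normc_1Ni divff// gt_eqF//.
exact: lt_le_trans ltr01 (sqrt_ge1 t).
Qed.

Lemma cayleyB s t : normc (cayley s - cayley t) =
  2 * `|s - t| / (Num.sqrt (1 + s ^+ 2) * Num.sqrt (1 + t ^+ 2)).
Proof.
have -> : cayley s - cayley t =
    (0 +i* (2 * (s - t)))%C / ((1 -i* s)%C * (1 -i* t)%C).
  rewrite /cayley.
  have : (1 +i* s)%C * (1 -i* t)%C - (1 +i* t)%C * (1 -i* s)%C =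
      (0 +i* (2 * (s - t)))%C :> R[i].
    by apply/eqP; rewrite eq_complex /=; apply/andP; split; apply/eqP; ring.
  by move=> <-; field; rewrite !neq0_1Ni.
rewrite normcM normcV normcM !normc_1Ni; congr (_ / _).
by rewrite /= expr0n add0r sqrtr_sqr normrM ger0_norm.
Qed.

Lemma cayley_dist_ub s t : normc (cayley s - cayley t) <= 2 * `|s - t|.
Proof.
rewrite cayleyB ler_pdivrMr; last first.
  by rewrite mulr_gt0// (lt_le_trans ltr01)// sqrt_ge1.
by apply: ler_peMr; [rewrite mulr_ge0|rewrite mulr_ege1 ?sqrt_ge1].
Qed.

Lemma cayley_dist_lb s t : `|s| <= 1 -> `|t| <= 1 ->
  `|s - t| <= normc (cayley s - cayley t).
Proof.
have sqrt_le (v : R) : `|v| <= 1 -> 0 <= Num.sqrt (1 + v ^+ 2) <= Num.sqrt 2.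
  move=> v1; rewrite sqrtr_ge0 ler_wsqrtr//=.
  by rewrite -[2]/(1 + 1 : R) lerD2l -real_normK ?num_real// expr_le1.
move=> /sqrt_le/andP[s0 s1] /sqrt_le/andP[t0 t1].
rewrite cayleyB ler_pdivlMr; last first.
  by rewrite mulr_gt0// (lt_le_trans ltr01)// sqrt_ge1.
rewrite mulrC ler_wpM2r//.
have -> : 2 = Num.sqrt 2 * Num.sqrt 2 :> R by rewrite -expr2 sqr_sqrtr.
by rewrite ler_pM.
Qed.

(** The two powers come from the variation of the denominator and from interpolation of the
    numerator; the last factor adds up the two terms of the quotient rule. One factor [n] comes from
    those terms, the other is kept in reserve for the sum over the [n] nodes when the bound is
    averaged over the circle. *)
Definition rational_const (n : nat) (a L : R) : R :=
  n%:R ^+ 2 * ((2 + L) ^+ n * (6 * n%:R * (1 + L) / a) ^+ n * (2 * n%:R / a + 1)).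

Lemma rational_const_ge1 n a L : (0 < n)%N -> 0 < a < 1 -> 0 <= L ->
  1 <= rational_const n a L.
Proof.
move=> n0 /andP[a0 a1] L0; have n1 : 1 <= n%:R :> R by rewrite ler1n.
have na : 1 <= n%:R / a.
  by rewrite ler_pdivlMr// mul1r (le_trans (ltW a1)).
rewrite /rational_const !mulr_ege1 ?exprn_ege1//; try lra.
by have -> : 6 * n%:R * (1 + L) / a = (6 * (n%:R / a)) * (1 + L); [ring|nra].
Qed.

(* [x] runs over [n] points of modulus [s]; up to bounded factors the
   denominator is constant within distance [d] of the poles, which reduces the
   bound to interpolation of the numerator. *)
Lemma rational_derivative_bound n (a L d rho s b : R) p q (zeta z : R[i]) (M : R) :
  (0 < n)%N -> 0 < a < 1 -> 0 <= L -> 0 < d <= 1 -> a <= s ->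
  `|rho - s| <= L * d -> normc zeta = 1 ->
  (size p <= n)%N -> (size q <= n.+1)%N ->
  q != 0 -> (forall x, normc x < b -> q.[x] != 0) ->
  0 <= rho -> rho + d <= b -> s <= 1 -> 1 < b ->
  (forall j : 'I_n, let x := s%:C%C * zeta * cayley (j%:R * (d / (2 * n%:R))) in
     normc (p.[x] / q.[x]) <= M) ->
  z = rho%:C%C * zeta ->
  normc ((p^`().[z] * q.[z] - p.[z] * q^`().[z]) / q.[z] ^+ 2) <=
    rational_const n a L / n%:R / d * M.
Proof.
move=> n0 /andP[a0 a1] L0 /andP[d0 d1] aS rs z1 szp szq q0 qb rho0 rhob s1 b1.
move=> pqM zE.
have s0 : 0 < s by exact: lt_le_trans aS.
have nR : 1 <= n%:R :> R by rewrite ler1n.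
have nR0 : 0 < n%:R :> R by exact: lt_le_trans ltr01 nR.
(* The parameters [j%:R * h] lie in [0, d / 2], hence in [-1, 1], and by [cayley_dist_ub] the nodes
   stay within [d] of s zeta. *)
pose h := d / (2 * n%:R).
have h0 : 0 < h by rewrite divr_gt0// mulr_gt0.
have hn : h * n%:R = d / 2.
  by rewrite /h; field; rewrite gt_eqF.
pose om (j : nat) := s%:C%C * zeta * cayley (j%:R * h).
pose xs := [seq om j | j <- iota 0 n].
have sxs : size xs = n by rewrite size_map size_iota.
have jh j : (j < n)%N -> 0 <= j%:R * h <= d / 2.
  move=> jn; rewrite mulr_ge0 ?(ltW h0)//= -hn mulrC ler_pM2l// ler_nat.
  exact: ltnW.
have sM u v : normc (s%:C%C * zeta * u - s%:C%C * zeta * v) = s * normc (u - v).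
  by rewrite -mulrBr !normcM normc_real z1 mulr1 gtr0_norm.
(* [D] bounds the distance from [z] to the nodes: [L * d] radially, then [d] along the circle. [e]
   bounds their separation from below, since two nodes are at least s h >= a h apart. *)
set D := (1 + L) * d; set e := a * h.
have e0 : 0 < e by rewrite mulr_gt0.
have dD : d <= D by rewrite ler_peMl ?(ltW d0)//; lra.
have h2 : h <= d / 2 by rewrite -hn ler_peMr// ltW.
have eD : e <= D.
  apply: le_trans dD; rewrite (@le_trans _ _ h)//.
    by rewrite ler_piMl// ltW.
  lra.
have zx x : x \in xs -> normc (z - x) <= D.
  case/mapP => j; rewrite mem_iota/= add0n => jn ->.
  have -> : z - om j = (rho - s)%:C%C * zeta +
      (s%:C%C * zeta * cayley 0 - s%:C%C * zeta * cayley (j%:R * h)).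
    rewrite zE /om rmorphB /=.
    have -> : cayley 0 = 1.
      by rewrite /cayley oppr0 divff// eq_complex /= oner_eq0.
    by ring.
  apply: le_trans (ler_normcD _ _) _.
  rewrite sM normcM z1 mulr1 normc_real /D mulrDl mul1r addrC lerD//.
  have := cayley_dist_ub 0 (j%:R * h); have /andP[j0 j1] := jh _ jn.
  rewrite sub0r normrN ger0_norm// => H.
  rewrite (le_trans (ler_piMl (normc_ge0 _) s1))// (le_trans H)//; lra.
have sep : pairwise (fun x y => e <= normc (x - y)) xs.
  rewrite pairwise_map; apply/(pairwiseP 0%N) => i j.
  rewrite !inE size_iota => iN jN ij; rewrite !nth_iota// !add0n /= /om sM.
  rewrite /e ler_pM ?(ltW a0) ?(ltW h0)//.
  apply: le_trans (cayley_dist_lb _ _).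
  - rewrite -mulrBl normrM (gtr0_norm h0) ler_peMl ?(ltW h0)//.
    by rewrite distrC -natrB ?(ltnW ij)// ger0_norm// ler1n subn_gt0.
  - by have /andP[? ?] := jh _ iN; rewrite ger0_norm//; lra.
  - by have /andP[? ?] := jh _ jN; rewrite ger0_norm//; lra.
(* The roots have modulus at least [b], while |z| = rho <= b - d. *)
have qd x : root q x -> d <= normc (z - x).
  move=> qx; have bx : b <= normc x.
    by rewrite leNgt; apply/negP => /qb; rewrite -rootE qx.
  have := ler_normcB z (z - x); rewrite opprB addrC subrK.
  rewrite [in normc z]zE normcM normc_real z1 mulr1 ger0_norm//; lra.
have [rs0 qE] := closed_field_poly_normal q.
have lq : lead_coef q != 0 by rewrite lead_coef_eq0.
have srs : (size rs0 <= n)%N.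
  by move: szq; rewrite qE size_scale// size_prod_XsubC ltnS.
have rd y : y \in rs0 -> d <= normc (z - y).
  by move=> yr; apply: qd; rewrite qE rootZ// root_prod_XsubC.
have [] := prod_XsubC_ratio d0 rd.
set q1 := \prod_(_ <- _) _ in qE *; move=> q1r q1d.
have qz0 : q.[z] != 0.
  apply/negP => qz; have := qd z; rewrite rootE => /(_ qz).
  by rewrite subrr normc0 leNgt d0.
set B := 1 + D / d.
have B1 : 1 <= B by rewrite lerDl divr_ge0// ?(ltW d0)// (le_trans (ltW d0)).
have qr x : x \in xs -> normc q.[x] <= B ^+ n * normc q.[z].
  move=> xx; rewrite qE !hornerZ !normcM mulrCA ler_wpM2l ?normc_ge0//.
  apply: le_trans (q1r x) _; rewrite ler_wpM2r ?normc_ge0//.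
  apply: (@le_trans _ _ (B ^+ size rs0)); last by rewrite ler_weXn2l.
  rewrite lerXn2r ?nnegrE ?addr_ge0 ?divr_ge0 ?normc_ge0 ?(ltW d0)//.
    by rewrite (le_trans (ltW d0)).
  by rewrite lerD2l ler_pM2r ?invr_gt0// normcBC zx.
have q'z : normc q^`().[z] <= n%:R / d * normc q.[z].
  rewrite qE derivZ !hornerZ !normcM mulrCA ler_wpM2l ?normc_ge0//.
  apply: le_trans q1d _; rewrite ler_wpM2r ?normc_ge0// ler_wpM2r//.
    by rewrite invr_ge0 ltW.
  by rewrite ler_nat.
have M0 : 0 <= M by have := pqM (Ordinal n0); apply: le_trans; exact: normc_ge0.
have Nq0 : 0 < normc q.[z] by rewrite normc_gt0.
have px x : x \in xs -> normc p.[x] <= M * B ^+ n * normc q.[z].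
  move=> xx.
  (* At a zero of [q] the quotient is 0 by convention and would say nothing about [p.[x]]. This case
     is void because the nodes have modulus s <= 1 < b. *)
  have [qx0|qx0] := eqVneq q.[x] 0.
    have : normc x < b.
      case/mapP: xx => j _ ->; rewrite normcM normc_cayley mulr1 normcM z1 normc_real.
      by rewrite mulr1 gtr0_norm// (le_lt_trans s1).
    by move=> /qb; rewrite qx0 eqxx.
  have : normc (p.[x] / q.[x]) <= M.
    case/mapP: xx => j; rewrite mem_iota/= add0n => jn ->.
    by have := pqM (Ordinal jn).
  rewrite normcM normcV ler_pdivrMr ?normc_gt0// => /le_trans; apply.
  by rewrite -mulrA ler_wpM2l// qr.
have [||pz p'z] := poly_interpolation_bound e0 eD zx sep _ _ px.
- by rewrite !mulr_ge0 ?exprn_ge0 ?normc_ge0// (le_trans ler01).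
- by rewrite sxs.
rewrite sxs in pz p'z.
set N := normc q.[z] in pz p'z q'z Nq0 *.
rewrite normcM normcV normcX -/N ler_pdivrMr ?exprn_gt0//.
apply: le_trans (ler_normcB _ _) _; rewrite !normcM -/N.
have {}p'z : normc p^`().[z] * N <=
    n%:R * (3 * (D / e)) ^+ n * (M * B ^+ n * N / e) * N.
  by rewrite ler_wpM2r// ltW.
have {}pz : normc p.[z] * normc q^`().[z] <=
    (3 * (D / e)) ^+ n * (M * B ^+ n * N) * (n%:R / d * N).
  by rewrite ler_pM ?normc_ge0.
apply: le_trans (lerD p'z pz) _.
have De : 3 * (D / e) = 6 * n%:R * (1 + L) / a.
  by rewrite /D /e /h; field; rewrite !gt_eqF.
have BE : B = 2 + L by rewrite /B /D; field; rewrite gt_eqF.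
have eE : e^-1 = 2 * n%:R / a / d by rewrite /e /h; field; rewrite !gt_eqF.
rewrite De BE eE /rational_const le_eqVlt; apply/orP; left; apply/eqP.
set X := _ ^+ n; set Y := (2 + L) ^+ n.
by field; rewrite !gt_eqF.
Qed.
End RationalBound.

(** * The complex derivative of a rational function *)

Section Derivative.
Variable R : realType.
Implicit Types (p q : {poly R[i]}) (z : R[i]).

Lemma is_derive_horner p z :
  is_derive (z : R[i]^o) 1 (horner p : R[i]^o -> R[i]^o) p^`().[z].
Proof.
elim/poly_ind: p => [|p c ih].
  rewrite deriv0 horner0.
  have -> : horner (0 : {poly R[i]}) = cst 0.
    by apply/funext => y; rewrite horner0.
  exact: is_derive_cst.
have -> : horner (p * 'X + c%:P) =
    (fun y : R[i]^o => (horner p * id) y + (cst c : _ -> R[i]^o) y).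
  by apply/funext => y; rewrite !hornerE.
have -> : (p * 'X + c%:P)^`().[z] =
    (p.[z] *: (1 : R[i]^o) + z *: (p^`().[z] : R[i]^o)) + 0.
  rewrite derivD derivM derivX derivC !hornerE addrC /GRing.scale /= mulr1.
  by rewrite [z * _]mulrC.
apply: is_deriveD.
Qed.

Lemma complex_derivative_rational p q z : q.[z] != 0 ->
  complex_derivative (fun z => p.[z] / q.[z]) z =
  (p^`() * q - p * q^`()).[z] / (q ^+ 2).[z].
Proof.
move=> qz0; rewrite /complex_derivative derive1E.
have [dp dpE] := is_derive_horner p z.
have [dq dqE] := is_derive_horner q z.
have dqV := @derivableV _ (R[i]^o) _ (z : R[i]^o) 1 qz0 dq.
have := deriveM dp dqV.
rewrite (deriveV qz0 dq) dpE dqE => H; rewrite [LHS]H {H}.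
rewrite horner_exp hornerD hornerN !hornerM.
have quotient_rule (F : fieldType) (a b a' b' : F) : b != 0 ->
    a * (- b ^- 2 * b') + b^-1 * a' = (a' * b - a * b') / b ^+ 2 by move=> ?; field.
exact: quotient_rule.
Qed.

End Derivative.

(** * Measurability in the angle and in the radius *)

Section Measurability.
Variable R : realType.
Local Notation RR := (measurableTypeR R).
Implicit Types (p q : {poly R[i]}).

(** Induction along the Horner scheme; the real and imaginary parts are carried together because
    multiplication by the variable mixes them. *)
Lemma measurable_horner d (T : measurableType d) (x y : T -> R) p :
  measurable_fun setT x -> measurable_fun setT y ->
  measurable_fun setT (fun t => complex.Re p.[x t +i* y t]%C) /\
  measurable_fun setT (fun t => complex.Im p.[x t +i* y t]%C).
Proof.
move=> mx my; elim/poly_ind: p => [|p c [ihr ihi]].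
  by split; under eq_fun do rewrite horner0 /=; exact: measurable_cst.
split.
- have -> : (fun t => complex.Re (p * 'X + c%:P).[x t +i* y t]%C) =
      (fun t => complex.Re p.[x t +i* y t]%C * x t
       - complex.Im p.[x t +i* y t]%C * y t + complex.Re c).
    by apply/funext => t; rewrite !hornerE; case: p.[_]; case: (c).
  apply: measurable_funD => //.
  by apply: measurable_funB; exact: measurable_funM.
- have -> : (fun t => complex.Im (p * 'X + c%:P).[x t +i* y t]%C) =
      (fun t => complex.Re p.[x t +i* y t]%C * y t
       + complex.Im p.[x t +i* y t]%C * x t + complex.Im c).
    by apply/funext => t; rewrite !hornerE; case: p.[_]; case: (c).
  apply: measurable_funD => //.
  by apply: measurable_funD; exact: measurable_funM.
Qed.

Lemma measurable_normc_horner d (T : measurableType d) (x y : T -> R) p :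
  measurable_fun setT x -> measurable_fun setT y ->
  measurable_fun setT (fun t => normc p.[x t +i* y t]%C).
Proof.
move=> mx my; have [mr mi] := measurable_horner p mx my.
have -> : (fun t => normc p.[x t +i* y t]%C) =
    (fun t => (complex.Re p.[x t +i* y t]%C ^+ 2 +
               complex.Im p.[x t +i* y t]%C ^+ 2) `^ 2^-1).
  by apply/funext => t; case: p.[_] => a b /=; rewrite powR12_sqrt// addr_ge0 ?sqr_ge0.
apply: measurableT_comp (measurable_powR _) _.
by apply: measurable_funD; exact: measurable_funX.
Qed.

Lemma measurable_rational d (T : measurableType d) (x y : T -> R) p q (e : R) :
  measurable_fun setT x -> measurable_fun setT y ->
  measurable_fun setT
    (fun t => (normc (p.[x t +i* y t]%C / q.[x t +i* y t]%C) `^ e)%:E).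
Proof.
move=> mx my; apply/measurable_EFinP.
apply: measurableT_comp (measurable_powR _) _.
(* The inverse as a power -1 is also correct at the zeros of [q], where both conventions give 0. *)
have -> : (fun t => normc (p.[x t +i* y t]%C / q.[x t +i* y t]%C)) =
    (fun t => normc p.[x t +i* y t]%C * (normc q.[x t +i* y t]%C) `^ (-1)).
  by apply/funext => t; rewrite normcM normcV powR_inv1// normc_ge0.
apply: measurable_funM; first exact: measurable_normc_horner.
apply: measurableT_comp (measurable_powR _) _.
exact: measurable_normc_horner.
Qed.

Lemma measurable_rational_circle p q (e : R) (z : R[i]) :
  measurable_fun (setT : set RR) (fun th =>
    (normc (p.[z * (cos th +i* sin th)%C] / q.[z * (cos th +i* sin th)%C]) `^ e)%:E).
Proof.
have mcos : measurable_fun (setT : set RR) (@cos R).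
  by apply: continuous_measurable_fun; exact: continuous_cos.
have msin : measurable_fun (setT : set RR) (@sin R).
  by apply: continuous_measurable_fun; exact: continuous_sin.
case: z => u v.
have E th : (u +i* v)%C * (cos th +i* sin th)%C =
    ((u * cos th - v * sin th) +i* (u * sin th + v * cos th))%C by [].
under eq_fun do rewrite E.
apply: measurable_rational.
  by apply: measurable_funB; apply: measurable_funM.
by apply: measurable_funD; apply: measurable_funM.
Qed.

(** Tonelli: the integrand, extended by zero off [0, 2 pi], is jointly measurable in radius and
    angle, so its integral over the angle is measurable in the radius. *)
Lemma measurable_circle_integral p q (e : R) :
  measurable_fun (setT : set RR) (fun rho => circle_integral (fun zeta =>
     (normc (p.[rho%:C%C * zeta] / q.[rho%:C%C * zeta]) `^ e)%:E)).
Proof.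
rewrite /circle_integral; apply: measurable_funeM.
set D : set RR := `[0, 2 * pi]%classic.
pose x (t : RR * RR) := t.1 * cos t.2.
pose y (t : RR * RR) := t.1 * sin t.2.
have mcos : measurable_fun (setT : set RR) (@cos R).
  by apply: continuous_measurable_fun; exact: continuous_cos.
have msin : measurable_fun (setT : set RR) (@sin R).
  by apply: continuous_measurable_fun; exact: continuous_sin.
have mx : measurable_fun setT x.
  by apply: measurable_funM => //; exact: measurableT_comp.
have my : measurable_fun setT y.
  by apply: measurable_funM => //; exact: measurableT_comp.
pose g (t : RR * RR) := (normc (p.[x t +i* y t]%C / q.[x t +i* y t]%C) `^ e)%:E.
have mg : measurable_fun setT g by exact: measurable_rational.
have mgD : measurable_fun setT (g \_ (setT `*` D)).
  apply/(measurable_restrictT _ _).1; last exact: measurable_funTS.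
  by apply: measurableX => //; exact: measurable_itv.
have g0 t : (0 <= (g \_ (setT `*` D)) t)%E.
  by rewrite erestrict_ge0// => v _; rewrite lee_fin powR_ge0.
have := measurable_fun_fubini_tonelli_F (m2 := @lebesgue_measure R) _ mgD g0.
congr (measurable_fun _ _); apply/funext => rho.
rewrite /fubini_F [RHS]integral_mkcond; apply: eq_integral => th _.
rewrite /patch /= in_setX in_setT /=; case: ifP => // _.
rewrite /g; suff -> : (x (rho, th) +i* y (rho, th))%C =
    rho%:C%C * (cos th +i* sin th)%C by [].
by rewrite /x /y /real_complex_def; simpc.
Qed.

(** Borel sets are Caratheodory measurable. This moves the circle averages to the completed space,
    where the weight is measurable. *)
Lemma measurable_completed (f : R -> \bar R) :
  measurable_fun (setT : set RR) f ->
  measurable_fun (setT : set (caratheodory_type (wlength (@idfun R))^*%mu)) f.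
Proof.
move=> mf _ Y mY; apply: sub_caratheodory.
exact: mf.
Qed.

End Measurability.

(** * Translation invariance of the Lebesgue measure and periodic functions *)

Section Rotation.
Variable R : realType.
Local Notation RR := (measurableTypeR R).
Local Notation mu := (@lebesgue_measure R).
Local Open Scope ereal_scope.

Lemma measurable_translate (a : R) :
  measurable_fun (setT : set RR) ((fun x => x + a)%R : RR -> RR).
Proof. by apply: measurable_funD. Qed.

(** By uniqueness of the Lebesgue measure it suffices to compare both sides on half-open
    intervals. *)
Lemma lebesgue_measure_translate (a : R) (A : set RR) : measurable A ->
  pushforward mu ((fun x => x + a)%R : RR -> RR) A = mu A.
Proof.
move=> mA.
pose f : {mfun RR >-> RR} := HB.pack ((fun x => x + a)%R : RR -> RR)
  (isMeasurableFun.Build _ _ _ _ _ (measurable_translate a)).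
apply/esym; apply: (@lebesgue_measure_unique R (pushforward mu f)) => //.
move=> _ [[u v]] _ <-.
transitivity (mu `](u - a)%R, (v - a)%R]); last first.
  rewrite /pushforward; congr (mu _); apply/seteqP.
  by split => x /=; rewrite !in_itv /= ltrBlDr lerBrDr.
rewrite !lebesgue_measure_itv/= !lte_fin ltrD2r; case: ifP => // _.
by rewrite -!EFinB; congr EFin; ring.
Qed.

Lemma ge0_integral_translate (a : R) (D : set RR) (f : RR -> \bar R) :
  measurable D -> measurable_fun setT f -> (forall x, 0 <= f x) ->
  \int[mu]_(x in (fun x : RR => x + a)%R @^-1` D) f (x + a)%R =
  \int[mu]_(x in D) f x.
Proof.
move=> mD mf f0.
have := ge0_integral_pushforward (measurable_translate a) mu mD
  (measurable_funTS mf) (fun y _ => f0 y).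
move=> /esym; rewrite /comp => ->.
apply: eq_measure_integral; first exact: measurable_translate.
by move=> mt A mA _; exact: lebesgue_measure_translate.
Qed.

(** After translation the left side is an integral over [a, T + a]. This interval shares [a, T] with
    [0, T], and the remaining pieces [T, T + a] and [0, a] differ by one period. *)
Lemma ge0_integral_periodic (T a : R) (f : RR -> \bar R) :
  (0 <= a <= T)%R -> measurable_fun setT f -> (forall x, 0 <= f x) ->
  (forall x, f (x + T)%R = f x) ->
  \int[mu]_(x in `[0%R, T]) f (x + a)%R = \int[mu]_(x in `[0%R, T]) f x.
Proof.
move=> /andP[a0 aT] mf f0 fT.
have mfS D := @measurable_funTS _ _ _ _ D f mf.
have shift (b x y : R) : `[x, y]%classic =
    (fun x : RR => x + b)%R @^-1` `[(x + b)%R, (y + b)%R]%classic :> set RR.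
  by apply/seteqP; split => t /=; rewrite !in_itv /= !lerD2r.
rewrite [in LHS](shift a) ge0_integral_translate// add0r.
have itvU (x y z : R) : (x <= y <= z)%R ->
    \int[mu]_(t in `[x, z]) f t =
    \int[mu]_(t in `[x, y]) f t + \int[mu]_(t in `[y, z]) f t.
  move=> /andP[xy yz].
  rewrite (@itv_bndbnd_setU _ _ _ (BLeft y)) ?bnd_simp//.
  rewrite ge0_integral_setU//.
  - by rewrite integral_itv_bndo_bndc//; exact: mfS.
  - apply/disj_setPS => t [] /=; rewrite !in_itv /= => /andP[_ ty] /andP[yt _].
    by move: ty; rewrite ltNge yt.
rewrite (@itvU a T) ?aT ?lerDl//.
rewrite [RHS](@itvU _ a) ?a0//.
rewrite addeC; congr (_ + _).
transitivity (\int[mu]_(x in `[0%R, a]) f (x + T)%R).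
  by rewrite [in RHS](shift T) ge0_integral_translate// add0r [(a + T)%R]addrC.
by apply: eq_integral => x _; rewrite fT.
Qed.

End Rotation.

(** * Rotation invariance of circle averages *)

Section CircleIntegral.
Variable R : realType.
Implicit Types (p q : {poly R[i]}).
Local Notation RR := (measurableTypeR R).

(** The coordinates are (1 - t^2) / (1 + t^2) and 2 t / (1 + t^2). The second is nonnegative, so the
    arc cosine of the first is an argument in [0, pi]. *)
Lemma cayley_polar (t : R) : 0 <= t -> exists2 a : R, 0 <= a <= pi &
  cayley t = (cos a +i* sin a)%C.
Proof.
move=> t0; have t1 : 0 < 1 + t ^+ 2 by rewrite ltr_pwDl// sqr_ge0.
have ct : cayley t = ((1 - t ^+ 2) / (1 + t ^+ 2) +i* (2 * t / (1 + t ^+ 2)))%C.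
  apply/eqP; rewrite /cayley eq_complex /=; apply/andP; split; apply/eqP;
  by rewrite expr1n sqrrN; field; rewrite gt_eqF.
set c := (1 - t ^+ 2) / (1 + t ^+ 2) in ct.
have c1 : -1 <= c <= 1.
  by rewrite ler_pdivlMr// ler_pdivrMr//; have := sqr_ge0 t; lra.
exists (acos c); first by rewrite acos_ge0// acos_lepi.
rewrite acosK ?in_itv//= sin_acos// ct; congr (_ +i* _)%C.
have -> : 1 - c ^+ 2 = (2 * t / (1 + t ^+ 2)) ^+ 2.
  by rewrite /c; field; rewrite gt_eqF.
by rewrite sqrtr_sqr ger0_norm// divr_ge0 ?mulr_ge0// ltW.
Qed.

Lemma circle_integral_rotation p q (e s t : R) : 0 <= t ->
  circle_integral (fun zeta => (normc (p.[s%:C%C * zeta * cayley t] /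
                                   q.[s%:C%C * zeta * cayley t]) `^ e)%:E) =
  circle_integral (fun zeta =>
    (normc (p.[s%:C%C * zeta] / q.[s%:C%C * zeta]) `^ e)%:E).
Proof.
move=> /cayley_polar[a /andP[a0 api] ->]; apply: (congr1 (mule _)).
pose F (th : RR) := (normc (p.[s%:C%C * (cos th +i* sin th)%C] /
  q.[s%:C%C * (cos th +i* sin th)%C]) `^ e)%:E.
transitivity (\int[@lebesgue_measure R]_(th in `[0%R, (2 * pi)%R]) F (th + a)%R)%E.
  apply: eq_integral => th _; rewrite /F -mulrA.
  suff -> : (cos th +i* sin th)%C * (cos a +i* sin a)%C =
    (cos (th + a) +i* sin (th + a))%C by [].
  by rewrite cosD sinD; simpc; congr (_ +i* _)%C; rewrite addrC.
apply: ge0_integral_periodic.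
- have := pi_ge0 R; rewrite a0 /=; lra.
- exact: measurable_rational_circle.
- by move=> x; rewrite lee_fin powR_ge0.
- by move=> x; rewrite /F mulr_natl cosD2pi sinD2pi.
Qed.

End CircleIntegral.

(** * The derivative bound averaged over circles *)

Section CircleBound.
Variable R : realType.
Local Notation RR := (measurableTypeR R).

(** This is M(s) for the function p / q; the exponent is called [e] because [p] is the numerator. *)
Definition circle_power (p q : {poly R[i]}) (e s : R) : \bar R :=
  circle_integral (fun zeta =>
    (normc (p.[s%:C%C * zeta] / q.[s%:C%C * zeta]) `^ e)%:E).

Lemma circle_integral_ge0 (g : R[i] -> \bar R) : (forall z, 0 <= g z)%E ->
  (0 <= circle_integral g)%E.
Proof.
move=> g0; apply: mule_ge0; last exact: integral_ge0.
by rewrite lee_fin invr_ge0 mulr_ge0// pi_ge0.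
Qed.

(** The maximum over the [n] nodes in the pointwise bound is replaced by a sum of [e]-th powers.
    Each node is a fixed rotation of s zeta, so after integration all summands equal the average
    over the circle of radius [s]. *)
Lemma circle_derivative_bound n (a L d rho s b e : R) (p q : {poly R[i]}) :
  (0 < n)%N -> 0 < a < 1 -> 0 <= L -> 0 < d <= 1 -> a <= s ->
  `|rho - s| <= L * d ->
  (size p <= n)%N -> (size q <= n.+1)%N ->
  q != 0 -> (forall x, normc x < b -> q.[x] != 0) ->
  0 <= rho -> rho + d <= b -> s <= 1 -> 1 < b -> 1 <= e ->
  (circle_power (p^`() * q - p * q^`()) (q ^+ 2) e rho <=
   ((rational_const n a L / d) `^ e)%:E * circle_power p q e s)%E.
Proof.
rewrite /circle_power => n0 a01 L0 d01 aS rs szp szq q0 qb rho0 rhob s1 b1 e1.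
have /andP[d0 d1] := d01.
have e0 : 0 < e by exact: lt_le_trans ltr01 e1.
have K1 := rational_const_ge1 n0 a01 L0.
set K := rational_const n a L in K1 *.
have K0 : 0 <= K by exact: le_trans ler01 K1.
have nR0 : 0 < n%:R :> R by rewrite ltr0n.
pose om (j : 'I_n) : R[i] := cayley (j%:R * (d / (2 * n%:R))).
pose k := (K / n%:R / d) `^ e.
have k0 : 0 <= k by rewrite powR_ge0.
pose G (j : 'I_n) (th : RR) := (normc (p.[s%:C%C * (cos th +i* sin th)%C * om j] /
  q.[s%:C%C * (cos th +i* sin th)%C * om j]) `^ e)%:E.
have mG j : measurable_fun (setT : set RR) (G j).
  rewrite /G; under eq_fun do rewrite -mulrA (mulrC _ (om j)) mulrA.
  exact: measurable_rational_circle.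
have G0 j th : (0 <= G j th)%E by rewrite lee_fin powR_ge0.
pose c := (2 * pi)^-1 : R.
have c0 : 0 <= c by rewrite invr_ge0 mulr_ge0// pi_ge0.
set D : set RR := `[0, 2 * pi]%classic.
have mD : measurable D by exact: measurable_itv.
have mS : measurable_fun D (fun th => \sum_(j <- enum 'I_n) G j th)%E.
  by apply: emeasurable_sum => j; exact: measurable_funTS.
apply: (@le_trans _ _ (c%:E * \int[@lebesgue_measure R]_(th in D)
    (k%:E * \sum_(j <- enum 'I_n) G j th))%E).
  rewrite /circle_integral lee_wpmul2l ?lee_fin//.
  apply: ge0_le_integral => //.
  - by move=> th _; rewrite lee_fin powR_ge0.
  - by apply: measurable_funTS; exact: measurable_rational_circle.
  - exact: measurable_funeM.
  move=> th _; rewrite sumEFin -EFinM lee_fin.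
  set S := (X in _ <= k * X).
  have S0 : 0 <= S by apply: sumr_ge0 => j _; rewrite powR_ge0.
  have Gj j : normc (p.[s%:C%C * (cos th +i* sin th)%C * om j] /
      q.[s%:C%C * (cos th +i* sin th)%C * om j]) <= S `^ e^-1.
    rewrite -[leLHS]powRr1 ?normc_ge0// -(@divff _ e) ?gt_eqF// powRrM.
    rewrite ge0_ler_powR ?nnegrE ?invr_ge0 ?(ltW e0) ?powR_ge0//.
    rewrite /S big_enum (bigD1 j)//= lerDl.
    by apply: sumr_ge0 => i _; rewrite powR_ge0.
  have z1 : normc (cos th +i* sin th)%C = 1.
    by rewrite /= cos2Dsin2 sqrtr1.
  have := rational_derivative_bound n0 a01 L0 d01 aS rs z1 szp szq q0 qb rho0
    rhob s1 b1 Gj erefl.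
  set z := _ * _ => H.
  have -> : S = (S `^ e^-1) `^ e by rewrite -powRrM mulVf ?powRr1 ?gt_eqF.
  have KK : 0 <= K / n%:R / d by rewrite !divr_ge0// ltW.
  have KS : 0 <= K / n%:R / d * S `^ e^-1 := mulr_ge0 KK (powR_ge0 _ _).
  rewrite -powRM ?powR_ge0//; apply: ge0_ler_powR;
    rewrite ?nnegrE ?normc_ge0 ?(ltW e0)//.
  by rewrite horner_exp hornerD hornerN !hornerM.
rewrite ge0_integralZl_EFin//; last by move=> th _; apply: sume_ge0.
rewrite ge0_integral_sum//; last by move=> j; exact: measurable_funTS.
rewrite muleCA ge0_sume_distrr; last first.
  by move=> j _; apply: integral_ge0 => th _.
rewrite (eq_bigr (fun=> circle_power p q e s)); last first.
  move=> j _; rewrite /circle_power.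
  rewrite -(@circle_integral_rotation _ p q e s (j%:R * (d / (2 * n%:R))))//.
  by rewrite mulr_ge0// divr_ge0 ?mulr_ge0// ltW.
rewrite big_enum sumr_const card_ord.
have natE (x : \bar R) : (x *+ n)%R = (n%:R%:E * x)%E by exact/esym/mule_natl.
rewrite natE muleA -EFinM.
apply: lee_wpmul2r; first by apply: circle_integral_ge0 => z; rewrite lee_fin powR_ge0.
rewrite lee_fin.
(* The [n] equal summands cost a factor [n], at most its [e]-th power, which the spare factor [n] of
   [K] absorbs. *)
have -> : K / d = n%:R * (K / n%:R / d) by field; rewrite !gt_eqF.
have KK : 0 <= K / n%:R / d := divr_ge0 (divr_ge0 K0 (ltW nR0)) (ltW d0).
rewrite powRM// ?(ltW nR0)// mulrC ler_wpM2r ?powR_ge0//.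
by apply: le1r_powR => //; rewrite ler1n.
Qed.

End CircleBound.

(** * Integrals over radii and their comparison *)

Section RadialIntegration.
Variable R : realType.
Local Notation TC := (caratheodory_type (wlength (@idfun R))^*%mu).
Local Notation mu := (@completed_lebesgue_measure R).

Lemma measurable_itv_completed (i : interval R) : measurable ([set` i] : set TC).
Proof. by apply: sub_caratheodory; exact: measurable_itv. Qed.

Lemma completed_lebesgue_measure_itvco (x y : R) : x <= y ->
  mu `[x, y[%classic = (y - x)%:E.
Proof.
move=> xy; have := lebesgue_measure_itv `[x, y[; rewrite /= lte_fin.
move=> H; transitivity (@lebesgue_measure R `[x, y[%classic); first by [].
rewrite H; case: ltP => [_|yx]; first by rewrite EFinB.
have -> : x = y by apply/eqP; rewrite eq_le xy yx.
by rewrite subrr.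
Qed.

Lemma integral_split3 (a y : R) (g : R -> \bar R) : 0 < a -> a <= y -> y <= 1 ->
  measurable_fun (`]0, 1[%classic : set TC) g ->
  (forall x : R, 0 < x < 1 -> (0 <= g x)%E) ->
  (\int[mu]_(x in `]0%R, 1%R[) g x =
   \int[mu]_(x in `]0%R, a[) g x + \int[mu]_(x in `[a, y[) g x +
   \int[mu]_(x in `[y, 1%R[) g x)%E.
Proof.
move=> a0 ay y1 mg g0.
have sub (i : interval R) : [set` i] `<=` `]0, 1[%classic ->
    measurable_fun ([set` i] : set TC) g.
  by move=> iI; apply: measurable_funS mg => //; exact: measurable_itv_completed.
have gI x : `]0, 1[%classic x -> (0 <= g x)%E.
  by rewrite /= in_itv /=; exact: g0.
have E1 : `]0, 1[%classic = `]0, y[%classic `|` `[y, 1[%classic :> set R.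
  by rewrite -itv_bndbnd_setU// bnd_simp// (lt_le_trans a0).
have E2 : `]0, y[%classic = `]0, a[%classic `|` `[a, y[%classic :> set R.
  by rewrite -itv_bndbnd_setU// bnd_simp.
have yI : `]0, y[ `<=` `]0, 1[%classic.
  by move=> t /=; rewrite !in_itv/= => /andP[-> ty]; rewrite (lt_le_trans ty).
rewrite [in LHS]E1 ge0_integral_setU//; first last.
- apply/disj_setPS => t [] /=; rewrite !in_itv /= => /andP[_ ty] /andP[yt _].
  by move: ty; rewrite ltNge yt.
- by rewrite -E1.
- by rewrite -E1.
- exact: measurable_itv_completed.
- exact: measurable_itv_completed.
rewrite [in LHS]E2 ge0_integral_setU//.
- exact: measurable_itv_completed.
- exact: measurable_itv_completed.
- by rewrite -E2; exact: sub.
- by rewrite -E2 => x /yI; exact: gI.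
- apply/disj_setPS => t [] /=; rewrite !in_itv /= => /andP[_ ty] /andP[yt _].
  by move: ty; rewrite ltNge yt.
Qed.

End RadialIntegration.

(* [g <= c * inf h] on [A], so both integrals are compared with [inf h]. *)
Lemma integral_le_cross d (T : measurableType d) (R : realType)
    (m : {measure set T -> \bar R}) (A B : set T) (v v' g h : T -> \bar R)
    (k c : R) :
  measurable A -> measurable B -> 0 <= k -> 0 < c ->
  measurable_fun A v -> measurable_fun A g ->
  measurable_fun B v' -> measurable_fun B h ->
  (forall x, A x -> 0 <= v x)%E -> (forall x, A x -> 0 <= g x)%E ->
  (forall x, B x -> 0 <= v' x)%E -> (forall x, B x -> 0 <= h x)%E ->
  (\int[m]_(x in A) v x <= k%:E * \int[m]_(x in B) v' x)%E ->
  (forall x y, A x -> B y -> g x <= c%:E * h y)%E ->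
  (\int[m]_(x in A) (v x * g x) <=
   (k * c)%:E * \int[m]_(x in B) (v' x * h x))%E.
Proof.
move=> mA mB k0 c0 mv mg mv' mh v0 g0 v'0 h0 vv' gh.
set i := ereal_inf (h @` B).
have i0 : (0 <= i)%E by apply: le_ereal_inf_tmp => _ [y By <-]; exact: h0.
have gi x : A x -> (g x <= c%:E * i)%E.
  move=> Ax; rewrite -lee_pdivrMl//; apply: le_ereal_inf_tmp => _ [y By <-].
  by rewrite lee_pdivrMl//; exact: gh.
have ci0 : (0 <= c%:E * i)%E by rewrite mule_ge0// lee_fin ltW.
apply: (@le_trans _ _ (\int[m]_(x in A) (v x * (c%:E * i)))%E).
  apply: ge0_le_integral => //.
  - by move=> x Ax; rewrite mule_ge0 ?v0 ?g0.
  - exact: emeasurable_funM.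
  - by apply: emeasurable_funM => //; exact: measurable_cst.
  - by move=> x Ax; rewrite lee_wpmul2l ?v0 ?gi.
rewrite ge0_integralZr//.
apply: (@le_trans _ _ (k%:E * \int[m]_(x in B) v' x * (c%:E * i))%E).
  by rewrite lee_wpmul2r.
rewrite muleACA -EFinM lee_wpmul2l ?lee_fin ?mulr_ge0 ?(ltW c0)//.
rewrite -ge0_integralZr//; apply: ge0_le_integral => //.
- by move=> x Bx; rewrite mule_ge0 ?v'0.
- by apply: emeasurable_funM => //; exact: measurable_cst.
- exact: emeasurable_funM.
- move=> x Bx; rewrite lee_wpmul2l ?v'0//.
  by apply: ereal_inf_lbound; exists x.
Qed.

(** * Inequalities for the three ranges and the choice of parameters *)

Lemma poweR_le_sum3 (R : realType) (e k : R) (X x y z : \bar R) :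
  1 <= e -> 0 <= k -> (0 <= X)%E -> (0 <= x)%E -> (0 <= y)%E -> (0 <= z)%E ->
  (x <= (k `^ e)%:E * X)%E -> (y <= (k `^ e)%:E * X)%E ->
  (z <= (k `^ e)%:E * X)%E ->
  ((x + y + z) `^ e^-1 <= (3 * k)%:E * X `^ e^-1)%E.
Proof.
move=> e1 k0 X0 x0 y0 z0 xX yX zX; have e0 : 0 < e by exact: lt_le_trans ltr01 e1.
have cX0 : (0 <= ((3 * k) `^ e)%:E * X)%E by rewrite mule_ge0// lee_fin powR_ge0.
apply: (@le_trans _ _ ((((3 * k) `^ e)%:E * X) `^ e^-1)%E); last first.
  rewrite poweRM ?lee_fin ?powR_ge0// poweR_EFin -powRrM mulfV ?gt_eqF//.
  by rewrite powRr1// mulr_ge0.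
apply: gt0_ler_poweR; rewrite ?invr_ge0 ?(ltW e0)// ?in_itv/= ?leey ?andbT//.
  by rewrite !adde_ge0.
apply: le_trans (leeD (leeD xX yX) zX) _.
rewrite -!ge0_muleDl ?adde_ge0 ?lee_fin ?powR_ge0// -!EFinD.
rewrite lee_wpmul2r// lee_fin powRM//.
have -> : k `^ e + k `^ e + k `^ e = 3 * k `^ e by ring.
(* Three terms cost a factor 3, which is at most its [e]-th power since e >= 1. *)
by rewrite ler_wpM2r ?powR_ge0// le1r_powR//; lra.
Qed.

(** Since 1 - x <= u and 1 - s > 2 u, the ratio (1 - x) / (1 - s) is at most 1 / 2, and its power
    [g] multiplies [ws]. Passing from the weight to the radius times the weight uses x <= 1 and 2 s
    >= 1, whence the factor 2. *)
Lemma weight_decay (R : realType) (g u x s wx ws : R) : 0 < u -> 3 * u <= 2^-1 ->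
  0 < g -> 1 - u <= x < 1 -> 1 - 3 * u <= s < 1 - 2 * u -> 0 <= wx -> 0 <= ws ->
  (1 - x) `^ (- g) * wx <= (1 - s) `^ (- g) * ws ->
  x * wx <= 2 * 2 `^ (- g) * (s * ws).
Proof.
move=> u0 u2 g0 /andP[xu x1] /andP[su s2] wx0 ws0.
have px : 0 < (1 - x) `^ g by rewrite powR_gt0 ?subr_gt0.
have ps : 0 < (1 - s) `^ g by rewrite powR_gt0// subr_gt0; lra.
rewrite -(@ler_pM2l _ ((1 - x) `^ g))//.
have -> : (1 - x) `^ g * ((1 - x) `^ (- g) * wx) = wx.
  by rewrite powRN mulrA mulfV ?mul1r// gt_eqF.
have gs : (1 - x) `^ g * (1 - s) `^ (- g) <= 2 `^ (- g).
  rewrite !powRN ler_pdivrMr// mulrC ler_pdivlMr ?powR_gt0// -powRM; try lra.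
  by apply: ge0_ler_powR; rewrite ?nnegrE; lra.
rewrite [leRHS]mulrA => /le_trans/(_ (ler_wpM2r ws0 gs)) H.
apply: (@le_trans _ _ (2 `^ (- g) * ws)).
  by apply: le_trans H; apply: ler_piMl => //; lra.
have -> : 2 * 2 `^ (- g) * (s * ws) = (2 * s) * (2 `^ (- g) * ws) by ring.
by apply: ler_peMl; [rewrite mulr_ge0// powR_ge0|lra].
Qed.

Lemma outer_ranges (R : realFieldType) (u x s : R) : 0 < u -> 3 * u <= 2^-1 ->
  1 - u <= x < 1 -> 1 - 3 * u <= s < 1 - 2 * u ->
  [/\ 0 < x < 1, 0 < s < 1, s <= x & `|x - s| <= 3 * u].
Proof.
move=> u0 u2 /andP[xu x1] /andP[su s2]; rewrite ler_norml.
by split; lra.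
Qed.

(** Every requirement is a lower bound on 1 / d, and 1 / d is taken to be the sum of these
    bounds. *)
Lemma small_parameter (R : realFieldType) (N B1 B2 c1 c2 : R) :
  1 < N -> 0 <= B1 -> 1 <= B2 -> 0 < c1 -> 0 < c2 ->
  exists d : R, [/\ 0 < d < 1, d <= N^-1, B1 <= d^-1 &
    [/\ 3 * (B2 * d) <= c1, 3 * (B2 * d) <= c2 & 3 * (B2 * d) <= 2^-1]].
Proof.
move=> N1 B10 B21 c10 c20.
pose x1 := 3 * B2 / c1; pose x2 := 3 * B2 / c2.
have x10 : 0 <= x1 by rewrite divr_ge0 ?ltW//; lra.
have x20 : 0 <= x2 by rewrite divr_ge0 ?ltW//; lra.
have E1 : 3 * B2 = x1 * c1 by rewrite divfK// gt_eqF.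
have E2 : 3 * B2 = x2 * c2 by rewrite divfK// gt_eqF.
move: x1 x2 x10 x20 E1 E2 => x1 x2 x10 x20 E1 E2.
pose T := N + B1 + x1 + x2 + 6 * B2.
have T0 : 0 < T by rewrite /T; lra.
have dT c y : c <= T -> 0 <= y -> c * y / T <= y.
  by move=> cT y0; rewrite ler_pdivrMr// mulrC ler_wpM2l.
exists T^-1; split.
- by rewrite invr_gt0 T0 invf_lt1// /T; lra.
- by rewrite lef_pV2 ?posrE//; [rewrite /T|]; lra.
- by rewrite invrK /T; lra.
- rewrite mulrA; split.
  + by rewrite E1 dT ?(ltW c10)// /T; lra.
  + by rewrite E2 dT ?(ltW c20)// /T; lra.
  + have := dT (6 * B2) 2^-1; have -> : 6 * B2 * 2^-1 = 3 * B2 by field.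
    by apply; rewrite /T; lra.
Qed.

(** * Bergman norms of rational functions *)

Section Bergman.
Variables (R : realType) (w : R -> R).
Hypothesis w_weight : is_weight w.
Local Notation TC := (caratheodory_type (wlength (@idfun R))^*%mu).
Local Notation mu := (@completed_lebesgue_measure R).

Definition radial_weight (rho : R) : \bar R := (rho * w rho)%:E.
Local Notation W := radial_weight.

Lemma radial_weight_ge0 (x : R) : 0 < x < 1 -> (0 <= W x)%E.
Proof.
move=> /[dup] x01 /andP[x0 x1].
by rewrite /W lee_fin mulr_ge0 ?(ltW x0)//; exact: w_weight.1.
Qed.

Lemma measurable_radial_weight : measurable_fun (`]0, 1[%classic : set TC) W.
Proof.
have mw := measurable_int _ w_weight.2.
have -> : W = (fun x : R => x%:E * (EFin \o w) x)%E.
  by apply/funext => x; rewrite /W EFinM.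
apply: emeasurable_funM => //; apply: measurable_funTS.
apply: (@measurable_completed R EFin); apply/measurable_EFinP.
exact: measurable_id.
Qed.

Let circle_power_ge0 (p q : {poly R[i]}) e s : (0 <= circle_power p q e s)%E.
Proof. by apply: circle_integral_ge0 => z; rewrite lee_fin powR_ge0. Qed.

Let circle_power_measurable (p q : {poly R[i]}) (e : R) (A : set TC) :
  measurable_fun A (circle_power p q e).
Proof.
apply: measurable_funTS; apply: measurable_completed.
exact: measurable_circle_integral.
Qed.

Let WF_measurable (p q : {poly R[i]}) (e : R) :
  measurable_fun (`]0, 1[%classic : set TC) (fun s => W s * circle_power p q e s)%E.
Proof.
apply: emeasurable_funM; first exact: measurable_radial_weight.
exact: circle_power_measurable.
Qed.

Let WF_ge0 (p q : {poly R[i]}) (e : R) x : 0 < x < 1 ->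
  (0 <= W x * circle_power p q e x)%E.
Proof. by move=> x01; rewrite mule_ge0// radial_weight_ge0. Qed.

Lemma subset_itv01 (i : interval R) : (i <= `]0, 1[)%O ->
  [set` i] `<=` `]0, 1[%classic.
Proof. by move=> iI x /= xi; exact: (subitvP iI). Qed.

Let WF_subset (p q : {poly R[i]}) (e : R) (i : interval R) : (i <= `]0, 1[)%O ->
  (\int[mu]_(s in [set` i]) (W s * circle_power p q e s) <=
   \int[mu]_(s in `]0%R, 1%R[) (W s * circle_power p q e s))%E.
Proof.
move=> /subset_itv01 iI; apply: ge0_subset_integral => //.
- exact: measurable_itv_completed.
- exact: measurable_itv_completed.
- by move=> x; rewrite /= in_itv /=; exact: WF_ge0.
Qed.

(** Agreement on the open disc is all the norm sees. For a derivative nothing more is available,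
    since the quotient rule needs a nonzero denominator. *)
Lemma bergman_norm_rational e (f : R[i] -> R[i]) (p q : {poly R[i]}) :
  (forall z, normc z < 1 -> f z = p.[z] / q.[z]) ->
  bergman_norm e w f =
  ((\int[mu]_(s in `]0%R, 1%R[) (W s * circle_power p q e s)) `^ e^-1)%E.
Proof.
move=> fE; rewrite /bergman_norm; apply: (congr1 (fun x => poweR x e^-1)).
apply: eq_integral => s; rewrite inE /= in_itv /= => /andP[s0 s1].
apply: (congr1 (mule (W s))); apply: (congr1 (mule _)).
apply: eq_integral => th _; rewrite fE// normcM normc_real gtr0_norm//.
have -> : normc (cos th +i* sin th)%C = 1 by rewrite /= cos2Dsin2 sqrtr1.
by rewrite mulr1.
Qed.

(** The circle averages are bounded crudely by +oo, which is enough because 0 * +oo = 0: the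
    integral of [W] times +oo vanishes with that of [W]. *)
Lemma bergman_norm_eq0 e (p q : {poly R[i]}) : 1 <= e ->
  (\int[mu]_(s in `]0%R, 1%R[) W s = 0)%E ->
  ((\int[mu]_(s in `]0%R, 1%R[) (W s * circle_power p q e s)) `^ e^-1 = 0)%E.
Proof.
move=> e1 W0; have e0 : 0 < e by exact: lt_le_trans ltr01 e1.
suff -> : (\int[mu]_(s in `]0%R, 1%R[) (W s * circle_power p q e s) = 0)%E.
  by rewrite poweR0r// invr_eq0 gt_eqF.
apply/eqP; rewrite eq_le; apply/andP; split; last first.
  by apply: integral_ge0 => x; rewrite /= in_itv/=; exact: WF_ge0.
have mI := measurable_itv_completed (`]0, 1[ : interval R).
have WI x : `]0, 1[%classic x -> (0 <= W x)%E.
  by rewrite /= in_itv/=; exact: radial_weight_ge0.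
have := ge0_integralZr mu mI measurable_radial_weight (k := +oo%E) WI (leey _).
rewrite W0 mul0e => <-.
apply: (ge0_le_integral mu mI).
- by move=> x; rewrite /= in_itv/=; exact: WF_ge0.
- exact: WF_measurable.
- apply: emeasurable_funM; first exact: measurable_radial_weight.
  exact: measurable_cst.
- move=> x; rewrite /= in_itv/= => x01.
  by rewrite lee_wpmul2l ?radial_weight_ge0// leey.
Qed.

Lemma bergman_norm_le e k (p q p1 q1 : {poly R[i]}) a y : 1 <= e -> 0 <= k ->
  0 < a -> a <= y -> y <= 1 ->
  let X := (\int[mu]_(s in `]0%R, 1%R[) (W s * circle_power p q e s))%E in
  let f s := (W s * circle_power p1 q1 e s)%E in
  (\int[mu]_(s in `]0%R, a[) f s <= (k `^ e)%:E * X)%E ->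
  (\int[mu]_(s in `[a, y[) f s <= (k `^ e)%:E * X)%E ->
  (\int[mu]_(s in `[y, 1%R[) f s <= (k `^ e)%:E * X)%E ->
  ((\int[mu]_(s in `]0%R, 1%R[) f s) `^ e^-1 <= (3 * k)%:E * X `^ e^-1)%E.
Proof.
move=> e1 k0 a0 ay y1 X f.
rewrite (integral_split3 a0 ay y1 (WF_measurable p1 q1 e) (@WF_ge0 p1 q1 e)).
have f0 (i : interval R) : (i <= `]0, 1[)%O -> (0 <= \int[mu]_(s in [set` i]) f s)%E.
  move=> iI; apply: integral_ge0 => x /(subset_itv01 iI).
  by rewrite /= in_itv/=; exact: WF_ge0.
have I1 : (`]0%R, a[ <= `]0, 1[ :> interval R)%O.
  by rewrite subitvE !bnd_simp /= (le_trans ay).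
have I2 : (`[a, y[ <= `]0, 1[ :> interval R)%O by rewrite subitvE !bnd_simp /= a0.
have I3 : (`[y, 1%R[ <= `]0, 1[ :> interval R)%O.
  by rewrite subitvE !bnd_simp /= (lt_le_trans a0).
have X0 : (0 <= X)%E.
  by apply: integral_ge0 => x; rewrite /= in_itv/=; exact: WF_ge0.
exact: poweR_le_sum3 e1 k0 X0 (f0 _ I1) (f0 _ I2) (f0 _ I3).
Qed.

(** * The three ranges of radii *)

Section Parts.
Variables (n : nat) (p q : {poly R[i]}) (e a b : R).
Hypotheses (n_gt0 : (0 < n)%N) (a01 : 0 < a < 1) (e_ge1 : 1 <= e).
Hypotheses (p_size : (size p <= n)%N) (q_size : (size q <= n.+1)%N).
Hypotheses (q_neq0 : q != 0) (b_gt1 : 1 < b).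
Hypothesis q_neq0_disc : forall x, normc x < b -> q.[x] != 0.

Local Notation p1 := (p^`() * q - p * q^`()).
Local Notation q1 := (q ^+ 2).
Local Notation X := (\int[mu]_(s in `]0%R, 1%R[) (W s * circle_power p q e s))%E.
Local Notation K := (rational_const n a).

Let K_gt0 L d : 0 <= L -> 0 < d -> 0 < K L / d.
Proof.
move=> L0 d0; apply: divr_gt0 => //.
exact: lt_le_trans ltr01 (rational_const_ge1 n_gt0 a01 L0).
Qed.

Let itvW (i : interval R) : (i <= `]0, 1[)%O ->
  measurable_fun ([set` i] : set TC) W.
Proof.
move=> iI; apply: measurable_funS measurable_radial_weight; last exact: subset_itv01.
exact: measurable_itv_completed.
Qed.

Let itvWF (p' q' : {poly R[i]}) (i : interval R) : (i <= `]0, 1[)%O ->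
  measurable_fun ([set` i] : set TC) (fun s => W s * circle_power p' q' e s)%E.
Proof.
move=> iI; apply: measurable_funS (WF_measurable _ _ _); last exact: subset_itv01.
exact: measurable_itv_completed.
Qed.

(** At scale [1 - a] with L = 1 / (1 - a), the allowed gap L (1 - a) = 1 covers any two radii, and
    poles of modulus at least b > 1 are farther than [1 - a] from a radius below [a]. So every
    radius below [a] compares with every radius above it, and [k] compares the masses. *)
Lemma inner_part (k : R) : 1 <= k ->
  (\int[mu]_(s in `]0%R, a[) W s <= k%:E * \int[mu]_(s in `[a, 1%R[) W s)%E ->
  (\int[mu]_(s in `]0%R, a[) (W s * circle_power p1 q1 e s) <=
   ((k * (K (1 - a)^-1 / (1 - a))) `^ e)%:E * X)%E.
Proof.
move=> k1 Wk; have /andP[a0 a1] := a01.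
have a1' : 0 < 1 - a by rewrite subr_gt0.
have k0 : 0 <= k by rewrite (le_trans ler01).
have Ka : 0 < K (1 - a)^-1 / (1 - a) by apply: K_gt0; rewrite ?invr_ge0 ?ltW.
have I1 : (`]0, a[ <= `]0, 1[ :> interval R)%O by rewrite subitvE !bnd_simp /= ltW.
have I2 : (`[a, 1[ <= `]0, 1[ :> interval R)%O by rewrite subitvE !bnd_simp /= a0.
have sI1 := subset_itv01 I1; have sI2 := subset_itv01 I2.
have WA x : `]0, a[%classic x -> (0 <= W x)%E.
  by move=> /sI1; rewrite /= in_itv/=; exact: radial_weight_ge0.
have WB x : `[a, 1[%classic x -> (0 <= W x)%E.
  by move=> /sI2; rewrite /= in_itv/=; exact: radial_weight_ge0.
have GF (x s : R) : `]0, a[%classic x -> `[a, 1[%classic s ->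
    (circle_power p1 q1 e x <=
     ((K (1 - a)^-1 / (1 - a)) `^ e)%:E * circle_power p q e s)%E.
  rewrite /= !in_itv /= => /andP[x0 xa] /andP[aS s1].
  have L0 : 0 <= (1 - a)^-1 by rewrite invr_ge0 ltW.
  have d01 : 0 < 1 - a <= 1 by rewrite a1' gerBl ltW.
  have xs : `|x - s| <= (1 - a)^-1 * (1 - a).
    by rewrite mulVf ?gt_eqF// ler_norml; lra.
  have xb : x + (1 - a) <= b by have := b_gt1; lra.
  exact: (circle_derivative_bound n_gt0 a01 L0 d01 aS xs p_size q_size q_neq0
    q_neq0_disc (ltW x0) xb (ltW s1) b_gt1 e_ge1).
have := @integral_le_cross _ TC R mu `]0, a[%classic `[a, 1[%classic W W
  (circle_power p1 q1 e) (circle_power p q e) k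
  ((K (1 - a)^-1 / (1 - a)) `^ e)
  (measurable_itv_completed _) (measurable_itv_completed _) k0
  (powR_gt0 _ Ka) (itvW I1) (@circle_power_measurable p1 q1 e _)
  (itvW I2) (@circle_power_measurable p q e _)
  WA (fun x _ => @circle_power_ge0 p1 q1 e x)
  WB (fun x _ => @circle_power_ge0 p q e x) Wk GF.
(* Since k >= 1, the factor [k] may be moved inside the [e]-th power. *)
move=> /le_trans; apply; apply: lee_pmul.
- by rewrite lee_fin mulr_ge0 ?powR_ge0.
- by apply: integral_ge0 => x /sI2; rewrite /= in_itv/=; exact: WF_ge0.
- by rewrite lee_fin le1r_powRZ// ltW.
- exact: WF_subset.
Qed.

(** Both sides are taken at the same radius, so [L] is 0 and the weight needs no comparison.
    Stopping at [y] allows a scale [d] larger than the distance from the poles to the unit disc. *)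
Lemma middle_part (y d : R) : a <= y -> y <= 1 -> 0 < d <= 1 -> y + d <= b ->
  (\int[mu]_(s in `[a, y[) (W s * circle_power p1 q1 e s) <=
   ((K 0 / d) `^ e)%:E * X)%E.
Proof.
move=> ay y1 d01 yd; have /andP[a0 a1] := a01; have /andP[d0 d1] := d01.
have Iy : (`[a, y[ <= `]0, 1[ :> interval R)%O by rewrite subitvE !bnd_simp /= a0.
have sI := subset_itv01 Iy.
have F0 (p' q' : {poly R[i]}) x : `[a, y[%classic x ->
    (0 <= W x * circle_power p' q' e x)%E.
  by move=> /sI; rewrite /= in_itv/=; exact: WF_ge0.
apply: (@le_trans _ _ (((K 0 / d) `^ e)%:E *
    \int[mu]_(s in `[a, y[) (W s * circle_power p q e s))%E); last first.
  by rewrite lee_wpmul2l ?lee_fin ?powR_ge0// WF_subset.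
have mI := measurable_itv_completed (`[a, y[ : interval R).
have := ge0_integralZl_EFin mu mI (@F0 p q) (itvWF p q Iy) (powR_ge0 (K 0 / d) e).
move=> <-; apply: (ge0_le_integral mu mI (@F0 p1 q1) (itvWF p1 q1 Iy)).
  exact: (measurable_funeM _ (itvWF p q Iy)).
move=> x xI; have x01 : 0 < x < 1 by have := sI _ xI; rewrite /= in_itv.
move: xI; rewrite /= in_itv/= => /andP[ax xy].
have xx : `|x - x| <= 0 * d by rewrite subrr normr0 mul0r.
have x0 : 0 <= x by rewrite (le_trans (ltW a0)).
have xb : x + d <= b by lra.
have x1 : x <= 1 by lra.
rewrite (muleCA ((K 0 / d) `^ e)%:E (W x) (circle_power p q e x)).
have := circle_derivative_bound n_gt0 a01 (lexx 0) d01 ax xx p_size q_size q_neq0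
  q_neq0_disc x0 xb x1 b_gt1 e_ge1.
by move=> /(lee_wpmul2l (radial_weight_ge0 x01)).
Qed.

(** The weight is part of the compared functions here: the decay of [w] and the circle bound give a
    pointwise factor [c] between any two radii of the two ranges. The condition on [g] makes [c] at
    most the [e]-th power of 1 / d. *)
Lemma outer_part (g r0 u d : R) : 0 < u -> 3 * u <= 1 - a -> 3 * u <= 2^-1 ->
  r0 <= 1 - 3 * u -> 0 < d <= 1 -> 1 + d <= b -> 0 < g ->
  {in `[r0, 1[ &, {homo (fun rho => (1 - rho) `^ (- g) * w rho) :
                      x y /~ x <= y}} ->
  2 * 2 `^ (- g) * K (3 * u / d) `^ e <= 1 ->
  (\int[mu]_(s in `[(1 - u)%R, 1%R[) (W s * circle_power p1 q1 e s) <=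
   (d^-1 `^ e)%:E * X)%E.
Proof.
move=> u0 ua u2 r0u d01 db g0 wd gK.
have /andP[a0 a1] := a01; have /andP[d0 d1] := d01.
(* L d = 3 u is the largest gap between radii of the two ranges. *)
set L := 3 * u / d in gK *.
have L0 : 0 <= L by rewrite divr_ge0 ?mulr_ge0// ltW.
pose c := 2 * 2 `^ (- g) * (K L / d) `^ e.
have c0 : 0 < c by rewrite !mulr_gt0 ?powR_gt0// K_gt0.
have IA : (`[(1 - u), 1[ <= `]0, 1[ :> interval R)%O.
  by rewrite subitvE !bnd_simp /= andbT; lra.
have IB : (`[(1 - 3 * u), (1 - 2 * u)[ <= `]0, 1[ :> interval R)%O.
  by rewrite subitvE !bnd_simp /=; lra.
have sA := subset_itv01 IA; have sB := subset_itv01 IB.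
have F0 (p' q' : {poly R[i]}) (i : interval R) : (i <= `]0, 1[)%O ->
    forall x, [set` i] x -> (0 <= W x * circle_power p' q' e x)%E.
  by move=> /subset_itv01 iI x /iI; rewrite /= in_itv/=; exact: WF_ge0.
have mA := measurable_itv_completed (`[(1 - u), 1[ : interval R).
have mB := measurable_itv_completed (`[(1 - 3 * u), (1 - 2 * u)[ : interval R).
have one0 (A : set TC) x : A x -> (0 <= (cst 1 : TC -> \bar R) x)%E.
  by move=> _; rewrite lee01.
(* Both ranges have length [u], so the comparison of masses costs no constant. *)
have AB : (\int[mu]_(x in `[(1 - u)%R, 1%R[) (cst 1 : TC -> \bar R) x <=
    1%:E * \int[mu]_(x in `[(1 - 3 * u)%R, (1 - 2 * u)%R[) (cst 1 : TC -> \bar R) x)%E.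
  have xu : 1 - u <= 1 by lra.
  have yu : 1 - 3 * u <= 1 - 2 * u by lra.
  have /= EA := completed_lebesgue_measure_itvco xu.
  have /= EB := completed_lebesgue_measure_itvco yu.
  rewrite (integral_cst mu mA) (integral_cst mu mB) !mul1e.
  by apply: (@le_trans _ _ u%:E); [rewrite [leLHS]EA|rewrite [leRHS]EB];
    rewrite lee_fin; lra.
have GF (x s : R) : `[(1 - u), 1[%classic x ->
    `[(1 - 3 * u), (1 - 2 * u)[%classic s ->
    (W x * circle_power p1 q1 e x <= c%:E * (W s * circle_power p q e s))%E.
  rewrite /= !in_itv /= => xI sI.
  have [x01 s01 sx xsu] := outer_ranges u0 u2 xI sI.
  have /andP[_ x1] := xI; have /andP[su _] := sI.
  have /andP[x0 _] := x01; have /andP[_ s1] := s01.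
  have wxs : x * w x <= 2 * 2 `^ (- g) * (s * w s).
    apply: (weight_decay u0 u2 g0 xI sI); [exact: w_weight.1..|].
    by apply: wd; rewrite ?in_itv/= ?x1 ?s1 ?andbT// ?(le_trans _ sx)//
      (le_trans r0u).
  have aS : a <= s by apply: le_trans su; rewrite lerBrDl -lerBrDr.
  have xs : `|x - s| <= L * d by rewrite /L divfK ?gt_eqF.
  have xb : x + d <= b by apply: le_trans db; rewrite lerD2r ltW.
  have Gx := circle_derivative_bound n_gt0 a01 L0 d01 aS xs p_size q_size q_neq0
    q_neq0_disc (ltW x0) xb (ltW s1) b_gt1 e_ge1.
  have -> : (c%:E * (W s * circle_power p q e s) =
    (2 * 2 `^ (- g) * (s * w s))%:E * (((K L / d) `^ e)%:E * circle_power p q e s))%E.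
    rewrite /c /W muleA [RHS]muleA -!EFinM; congr (_%:E * _)%E; ring.
  apply: lee_pmul Gx; last by rewrite lee_fin.
    exact: radial_weight_ge0.
  exact: circle_power_ge0.
have := @integral_le_cross _ TC R mu _ _ (cst 1%E) (cst 1%E)
  (fun s => W s * circle_power p1 q1 e s)%E
  (fun s => W s * circle_power p q e s)%E 1 c mA mB ler01 c0
  (measurable_cst _) (itvWF _ _ IA) (measurable_cst _) (itvWF _ _ IB)
  (one0 _) (F0 p1 q1 _ IA) (one0 _) (F0 p q _ IB) AB GF.
under eq_integral do rewrite mul1e.
under [in X in (_ <= X)%E -> _]eq_integral do rewrite mul1e.
move=> /le_trans; apply; rewrite mul1r; apply: lee_pmul.
- by rewrite lee_fin ltW.
- by apply: integral_ge0; exact: F0.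
- rewrite lee_fin /c powRM ?invr_ge0 ?(ltW d0)//; last first.
    by rewrite (le_trans ler01)// rational_const_ge1.
  by rewrite mulrA ler_piMl ?powR_ge0.
- exact: WF_subset.
Qed.

End Parts.
End Bergman.

(** * Bounds for the best constant *)

Section BestConstant.
Variables (R : realType) (w : R -> R).
Hypothesis w_weight : is_weight w.
Local Notation TC := (caratheodory_type (wlength (@idfun R))^*%mu).
Local Notation mu := (@completed_lebesgue_measure R).
Local Notation W := (radial_weight w).

Lemma best_constant_fin_num n (r c : R) (N : (R[i] -> R[i]) -> \bar R) : 0 <= c ->
  (forall f, rational_class n r f -> (N (complex_derivative f) <= c%:E * N f)%E) ->
  best_constant n r N \is a fin_num /\ 0 <= fine (best_constant n r N) <= c.
Proof.
move=> c0 cN; have b0 : (0 <= best_constant n r N)%E.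
  by apply: le_ereal_inf_tmp => _ [k [k0 _] <-]; rewrite lee_fin.
have bc : (best_constant n r N <= c%:E)%E.
  by apply: ereal_inf_lbound; exists c.
have bfin : best_constant n r N \is a fin_num.
  by rewrite ge0_fin_numE// (le_lt_trans bc)// ltry.
by split=> //; rewrite -!lee_fin fineK// b0.
Qed.

Lemma integral_radial_weight_lty : (\int[mu]_(s in `]0%R, 1%R[) W s < +oo)%E.
Proof.
have /integrableP[mw] := w_weight.2; apply: le_lt_trans.
have mI := measurable_itv_completed (`]0, 1[ : interval R).
apply: (ge0_le_integral mu mI).
- by move=> x; rewrite /= in_itv/=; exact: (radial_weight_ge0 w_weight).
- exact: (measurable_radial_weight w_weight).
- exact: measurableT_comp.
- move=> x; rewrite /= in_itv/= => /andP[x0 x1].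
  have w0 : 0 <= w x by apply: w_weight.1; rewrite x0.
  by rewrite lee_fin ger0_norm// ler_piMl// ltW.
Qed.

Let W_fin_num (i : interval R) : (i <= `]0, 1[)%O ->
  (\int[mu]_(s in [set` i]) W s)%E \is a fin_num.
Proof.
move=> /subset_itv01 iI; rewrite ge0_fin_numE; last first.
  apply: integral_ge0 => x /iI; rewrite /= in_itv/=.
  exact: (radial_weight_ge0 w_weight).
apply: le_lt_trans integral_radial_weight_lty.
have WI x : `]0, 1[%classic x -> (0 <= W x)%E.
  by rewrite /= in_itv/=; exact: (radial_weight_ge0 w_weight).
exact: (ge0_subset_integral mu (measurable_itv_completed _)
  (measurable_itv_completed _) (measurable_radial_weight w_weight) WI iI).
Qed.

(** If every [a, 1) had mass zero, monotone convergence along the increasing intervals [1 / (j + 2),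
    1) would make the total mass zero. Once [a, 1) has positive mass, finiteness of the masses gives
    [k] as their quotient, raised to at least 1. *)
Lemma radial_weight_mass : (\int[mu]_(s in `]0%R, 1%R[) W s != 0)%E ->
  exists2 a : R, 0 < a < 1 & exists2 k : R, 1 <= k &
  (\int[mu]_(s in `]0%R, a[) W s <= k%:E * \int[mu]_(s in `[a, 1%R[) W s)%E.
Proof.
move=> W0.
have itv_le (a : R) : 0 < a -> (`[a, 1%R[ <= `]0, 1[ :> interval R)%O.
  by move=> a0; rewrite subitvE !bnd_simp /= a0.
have [a a01 Wa] : exists2 a : R, 0 < a < 1 & (\int[mu]_(s in `[a, 1%R[) W s != 0)%E.
  apply: contrapT => H; move/negP: W0; apply.
  pose F (j : nat) : set TC := `[j.+2%:R^-1, 1%R[%classic.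
  have F0 j : 0 < j.+2%:R^-1 :> R by rewrite invr_gt0.
  have FW j : (\int[mu]_(s in F j) W s = 0)%E.
    apply/eqP; apply: contrapT => /negP Fj; apply: H.
    by exists j.+2%:R^-1 => //; rewrite F0 invf_lt1// ltr1n.
  have ndF : {homo F : j l / (j <= l)%N >-> (j <= l)%O}.
    move=> j l jl; apply/subsetPset => x; rewrite /F /= !in_itv/= => /andP[jx ->].
    by rewrite andbT (le_trans _ jx)// lef_pV2 ?posrE// ler_nat.
  have mF j : measurable (F j) by exact: measurable_itv_completed.
  have mWF j : measurable_fun (F j) W.
    apply: measurable_funS (measurable_radial_weight w_weight).
      exact: measurable_itv_completed.
    exact/subset_itv01/itv_le.
  have F_ge0 j x : F j x -> (0 <= W x)%E.
    move=> /(subset_itv01 (itv_le _ (F0 j))); rewrite /= in_itv/=.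
    exact: (radial_weight_ge0 w_weight).
  have := ge0_nondecreasing_set_cvg_integral (mu := mu) ndF mF mWF F_ge0.
  have -> : \bigcup_j F j = `]0, 1[%classic.
    apply/seteqP; split => [x [j _ /(subset_itv01 (itv_le _ (F0 j)))]//|x].
    rewrite /= in_itv/= => /andP[x0 x1].
    have [j jx] : exists j : nat, x^-1 < j%:R.
      by exists (Num.truncn x^-1).+1; exact: truncnS_gt.
    exists j => //; rewrite /F /= in_itv/= x1 andbT.
    rewrite -[leRHS]invrK lef_pV2 ?posrE ?invr_gt0//.
    by rewrite (le_trans (ltW jx))// ler_nat -addn2 leq_addr.
  under eq_fun do rewrite FW.
  move=> /cvg_lim; rewrite lim_cst// => H0; apply/eqP.
  by rewrite -H0.
exists a => //; have /andP[a0 a1] := a01.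
have I1 : (`]0%R, a[ <= `]0, 1[ :> interval R)%O by rewrite subitvE !bnd_simp /= ltW.
have A := W_fin_num I1; have B := W_fin_num (itv_le _ a0).
have WB : 0 < fine (\int[mu]_(s in `[a, 1%R[) W s)%E.
  rewrite lt_def fine_eq0// Wa fine_ge0//.
  apply: integral_ge0 => x /(subset_itv01 (itv_le _ a0)).
  by rewrite /= in_itv/=; exact: (radial_weight_ge0 w_weight).
exists (Num.max 1 (fine (\int[mu]_(s in `]0%R, a[) W s)%E /
  fine (\int[mu]_(s in `[a, 1%R[) W s)%E)); first by rewrite le_max lexx.
rewrite -(fineK A) -(fineK B) -EFinM lee_fin -ler_pdivrMr//=.
by rewrite le_max lexx orbT.
Qed.

(** The strict degree inequality is what makes [n] interpolation nodes enough for the numerator. *)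
Lemma rational_classP n (r : R) f : 0 < r < 1 -> rational_class n r f ->
  exists p q : {poly R[i]}, [/\ (size p <= n)%N, (size q <= n.+1)%N, q != 0,
    (forall x, normc x < r^-1 -> q.[x] != 0) & f = (fun z => p.[z] / q.[z])].
Proof.
move=> r01 [p [q [_ sq pq qr ->]]]; exists p, q; split => //.
- by rewrite -ltnS (leq_trans pq).
- by rewrite -size_poly_gt0 (leq_ltn_trans _ pq).
Qed.

Lemma bergman_derivative_norm (r e : R) (p q : {poly R[i]}) : 0 < r < 1 ->
  (forall x, normc x < r^-1 -> q.[x] != 0) ->
  bergman_norm e w (complex_derivative (fun z => p.[z] / q.[z])) =
  ((\int[mu]_(s in `]0%R, 1%R[)
    (W s * circle_power (p^`() * q - p * q^`()) (q ^+ 2) e s)) `^ e^-1)%E.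
Proof.
move=> /andP[r0 r1] qr; apply: bergman_norm_rational => z z1.
by rewrite complex_derivative_rational// qr// (lt_trans z1)// invf_gt1.
Qed.

Let K := @rational_const R.

Let le_powR_mul (e k1 k2 : R) (x X : \bar R) : 1 <= e -> 0 <= k1 -> k1 <= k2 ->
  (0 <= X)%E -> (x <= (k1 `^ e)%:E * X)%E -> (x <= (k2 `^ e)%:E * X)%E.
Proof.
move=> e1 k10 k12 X0 /le_trans; apply; apply: lee_wpmul2r => //.
by rewrite lee_fin; apply: ge0_ler_powR; rewrite ?nnegrE//; lra.
Qed.

(** The poles allowed by the parameter 1 - d are at distance at least [d] from the unit disc. *)
Let inv_onem (d : R) : 0 < d < 1 -> 1 + d <= (1 - d)^-1 /\ 1 < (1 - d)^-1.
Proof.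
move=> /andP[d0 d1]; have d1' : 0 < 1 - d by rewrite subr_gt0.
split; first by rewrite -[leRHS]mul1r ler_pdivlMr//; nra.
by rewrite invf_gt1//; lra.
Qed.

Let X_ge0 (p q : {poly R[i]}) e :
  (0 <= \int[mu]_(s in `]0%R, 1%R[) (W s * circle_power p q e s))%E.
Proof.
apply: integral_ge0 => x; rewrite /= in_itv/= => x01.
rewrite mule_ge0 ?(radial_weight_ge0 w_weight)//.
by apply: circle_integral_ge0 => z; rewrite lee_fin powR_ge0.
Qed.

(** A crude bound for every exponent, including those above [n], which gives finiteness of the best
    constant. The outer range is empty: the middle one runs up to 1 at scale [d]. *)
Lemma derivative_norm_bound n (a k e d : R) f : (0 < n)%N -> 0 < a < 1 -> 1 <= k ->
  (\int[mu]_(s in `]0%R, a[) W s <= k%:E * \int[mu]_(s in `[a, 1%R[) W s)%E ->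
  1 <= e -> 0 < d < 1 -> rational_class n (1 - d) f ->
  (bergman_norm e w (complex_derivative f) <=
   (3 * (k * (K n a (1 - a)^-1 / (1 - a)) + K n a 0 / d))%:E * bergman_norm e w f)%E.
Proof.
move=> n0 a01 k1 Wk e1 d01 fR; have /andP[a0 a1] := a01; have /andP[d0 d1] := d01.
have r01 : 0 < 1 - d < 1 by lra.
have [p [q [sp sq q0 qr ->]]] := rational_classP r01 fR.
have [db b1] := inv_onem d01.
rewrite (bergman_derivative_norm e p r01 qr).
rewrite (@bergman_norm_rational R w e _ p q (fun z _ => erefl)).
have a1' : 0 < 1 - a by rewrite subr_gt0.
have B1 : 0 <= k * (K n a (1 - a)^-1 / (1 - a)).
  rewrite mulr_ge0 ?divr_ge0 ?(ltW a1')//; first exact: le_trans ler01 k1.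
  by rewrite (le_trans ler01)// rational_const_ge1// invr_ge0 ltW.
have B2 : 0 <= K n a 0 / d.
  by rewrite divr_ge0 ?(ltW d0)// (le_trans ler01)// rational_const_ge1.
have d01' : 0 < d <= 1 by rewrite d0 ltW.
apply: (bergman_norm_le w_weight e1 (addr_ge0 B1 B2) a0 (ltW a1) (lexx 1)).
- apply: (le_powR_mul e1 B1 _ (X_ge0 p q e)); first by rewrite lerDl.
  exact: (inner_part w_weight n0 a01 e1 sp sq q0 b1 qr k1 Wk).
- apply: (le_powR_mul e1 B2 _ (X_ge0 p q e)); first by rewrite lerDr.
  exact: (middle_part w_weight n0 a01 e1 sp sq q0 b1 qr (ltW a1) (lexx 1) d01' db).
- rewrite set_itvco0 integral_set0; apply: mule_ge0; last exact: X_ge0.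
  by rewrite lee_fin powR_ge0.
Qed.

Hypothesis w_decr : super_polynomially_decreasing w.

Lemma sharp_derivative_norm_bound n (a k : R) : (0 < n)%N -> 0 < a < 1 -> 1 <= k ->
  (\int[mu]_(s in `]0%R, a[) W s <= k%:E * \int[mu]_(s in `[a, 1%R[) W s)%E ->
  exists d : R, [/\ 0 < d < 1, d <= n.+1%:R^-1 & forall e f,
    1 <= e <= n%:R -> rational_class n (1 - d) f ->
    (bergman_norm e w (complex_derivative f) <=
     (3 * d^-1)%:E * bergman_norm e w f)%E].
Proof.
move=> n0 a01 k1 Wk; have /andP[a0 a1] := a01.
have a1' : 0 < 1 - a by rewrite subr_gt0.
have L10 : 0 <= (1 - a)^-1 by rewrite invr_ge0 ltW.
pose B1 := k * (K n a (1 - a)^-1 / (1 - a)).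
have B10 : 0 <= B1.
  rewrite mulr_ge0 ?divr_ge0 ?(ltW a1')//; first exact: le_trans ler01 k1.
  by rewrite (le_trans ler01)// rational_const_ge1.
(* [B2] is the middle constant, and the scale there will be u = B2 d, so that B2 / u is exactly 1 /
   d. The outer constant [B3] has L = 3 u / d = 3 B2; neither depends on [d]. *)
pose B2 := K n a 0; have B21 : 1 <= B2 by exact: rational_const_ge1.
pose B3 := K n a (3 * B2).
have B31 : 1 <= B3 by apply: rational_const_ge1 => //; lra.
(* The decay exponent [m] must beat 2 times the [e]-th power of [B3]. The [n]-th power dominates for
   all e <= n, so [m], then [r0], and last [d] are chosen before the exponent. *)
pose m := (Num.truncn (2 * B3 ^+ n)).+1.
have m2 : 2 * B3 ^+ n <= 2 ^+ m.
  apply: (@le_trans _ _ m%:R); first exact/ltW/truncnS_gt.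
  by rewrite -natrX ler_nat ltnW// ltn_expl.
have g0 : 0 < m%:R :> R by rewrite ltr0n.
have [r0 /andP[r00 r01] wd] := w_decr g0.
have n1 : 1 < n.+1%:R :> R by rewrite ltr1n.
have r01' : 0 < 1 - r0 by rewrite subr_gt0.
have [d [d01 dn B1d [ua ur u2]]] := small_parameter n1 B10 B21 a1' r01'.
have /andP[d0 d1] := d01.
have u0 : 0 < B2 * d by rewrite mulr_gt0// (lt_le_trans ltr01).
exists d; split=> //.
move=> e f /andP[e1 en] fR.
have r1d : 0 < 1 - d < 1 by rewrite subr_gt0 d1 gtrBl.
have [p [q [sp sq q0 qr ->]]] := rational_classP r1d fR.
have [db b1] := inv_onem d01.
rewrite (bergman_derivative_norm e p r1d qr).
rewrite (@bergman_norm_rational R w e _ p q (fun z _ => erefl)).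
have d01' : 0 < d <= 1 by rewrite d0 ltW.
have dV0 : 0 <= d^-1 by rewrite invr_ge0 ltW.
have u3 : B2 * d <= 3 * (B2 * d) by apply: ler_peMl; [exact: ltW|rewrite ler1n].
set u := B2 * d in u0 u3 ua ur u2 *.
have ay : a <= 1 - u by rewrite lerBrDl -lerBrDr (le_trans u3).
have y1 : 1 - u <= 1 by rewrite gerBl ltW.
apply: (bergman_norm_le w_weight e1 dV0 a0 ay y1).
- apply: (le_powR_mul e1 B10 B1d (X_ge0 p q e)).
  exact: (inner_part w_weight n0 a01 e1 sp sq q0 b1 qr k1 Wk).
- have u1 : u <= 1 by rewrite (le_trans u3)// (le_trans u2)// invf_le1// ler1n.
  have u01 : 0 < u <= 1 by rewrite u0.
  have yb : 1 - u + u <= (1 - d)^-1 by rewrite subrK ltW.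
  have := middle_part w_weight n0 a01 e1 sp sq q0 b1 qr ay y1 u01 yb.
  suff -> : rational_const n a 0 / u = d^-1 by [].
  rewrite /u -[rational_const n a 0]/B2 invfM mulrA mulfV ?mul1r// gt_eqF//.
  exact: lt_le_trans ltr01 B21.
- have r0u : r0 <= 1 - 3 * u by rewrite lerBrDl -lerBrDr.
  apply: (outer_part w_weight n0 a01 e1 sp sq q0 b1 qr u0 ua u2 r0u d01' db g0 wd).
  have -> : 3 * u / d = 3 * B2 by rewrite /u; field; rewrite gt_eqF.
  rewrite powRN powR_mulrn// -[X in _ * X]/(B3 `^ e).
  have BE : B3 `^ e <= B3 ^+ n.
    by rewrite -powR_mulrn ?(le_trans ler01)// ler_powR.
  rewrite mulrAC ler_pdivrMr ?exprn_gt0// mul1r (le_trans _ m2)//.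
  by rewrite ler_pM2l.
Qed.

End BestConstant.

(** * The sequence and the asymptotic estimate *)

Theorem theorem1p5 (R : realType) (w : R -> R)
    (w_weight : is_weight w) (w_decr : super_polynomially_decreasing w) :
  exists r : nat -> R,
    [/\ forall n : nat, (1 <= n)%N -> 0 < r n < 1,
        r n @[n --> \oo] --> (1 : R) &
        forall p : R, 1 <= p ->
          (forall n : nat, (1 <= n)%N ->
             best_constant n (r n) (bergman_norm p w) \is a fin_num) /\
          (fun n : nat =>
             fine (best_constant n (r n) (bergman_norm p w)) / n%:R)
          =o_\oo (fun n : nat => (1 - r n)^-1)].
Proof.
(* One [d n] serves all exponents: finiteness holds for every e >= 1, the sharp bound only for e <=
   n. *)
have [d dP] : exists d : nat -> R, forall n, [/\ 0 < d n < 1, d n <= n.+1%:R^-1,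
    (forall e, 1 <= e -> (0 < n)%N ->
      best_constant n (1 - d n) (bergman_norm e w) \is a fin_num) &
    (forall e, (0 < n)%N -> 1 <= e <= n%:R ->
      0 <= fine (best_constant n (1 - d n) (bergman_norm e w)) <= 3 * (d n)^-1)].
  suff /choice[d dP] : forall n, exists d : R, [/\ 0 < d < 1, d <= n.+1%:R^-1,
    (forall e, 1 <= e -> (0 < n)%N ->
      best_constant n (1 - d) (bergman_norm e w) \is a fin_num) &
    (forall e, (0 < n)%N -> 1 <= e <= n%:R ->
      0 <= fine (best_constant n (1 - d) (bergman_norm e w)) <= 3 * d^-1)].
    by exists d.
  move=> n; have half : 0 < (n.+2%:R^-1 : R) < 1.
    by rewrite invr_gt0 ltr0n invf_lt1// ltr1n.
  have half_le : n.+2%:R^-1 <= n.+1%:R^-1 :> R by rewrite lef_pV2 ?posrE// ler_nat.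
  (* The index 0 carries no constraint on the constants and receives a dummy value. *)
  case: (posnP n) => [->|n0].
    exists 2^-1; split=> //; last by rewrite invr1 invf_le1// ler1n.
    by rewrite invr_gt0 ltr0n invf_lt1// ltr1n.
  (* If the radial mass vanishes, so do all the norms; 0 is then an admissible constant and any
     small [d] will do. *)
  have [W0|W0] := eqVneq (\int[@completed_lebesgue_measure R]_(s in `]0%R, 1%R[)
      radial_weight w s)%E 0%E.
    have bE e f : 1 <= e -> rational_class n (1 - n.+2%:R^-1) f ->
        (bergman_norm e w (complex_derivative f) <= 0%:E * bergman_norm e w f)%E.
      move=> e1 fR; have /andP[h0 h1] := half.
      have r01 : 0 < (1 - n.+2%:R^-1 : R) < 1 by rewrite subr_gt0 h1 gtrBl.
      have [p [q [_ _ _ qr ->]]] := rational_classP r01 fR.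
      rewrite (bergman_derivative_norm w e p r01 qr) mul0e.
      by rewrite (bergman_norm_eq0 w_weight _ _ e1 W0).
    exists n.+2%:R^-1; split=> // e.
      by move=> e1 _; have [] := best_constant_fin_num (lexx 0) (fun f => bE e f e1).
    move=> _ /andP[e1 _].
    have [_ /andP[f0 f1]] := best_constant_fin_num (lexx 0) (fun f => bE e f e1).
    by rewrite f0 (le_trans f1)// mulr_ge0// invrK ler0n.
  have [a a01 [k k1 Wk]] := radial_weight_mass w_weight W0.
  have [d [d01 dn dB]] := sharp_derivative_norm_bound w_weight w_decr n0 a01 k1 Wk.
  have d0 : 0 <= d by case/andP: d01 => /ltW.
  exists d; split=> // e.
    move=> e1 _.
    pose c := 3 * (k * (rational_const n a (1 - a)^-1 / (1 - a)) + rational_const n a 0 / d).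
    have cB f := derivative_norm_bound (f := f) w_weight n0 a01 k1 Wk e1 d01.
    have c0 : 0 <= c.
      have /andP[a0 a1] := a01; have a1' : 0 <= 1 - a by rewrite subr_ge0 ltW.
      have rc0 L : 0 <= L -> 0 <= rational_const n a L.
        by move=> L0; rewrite (le_trans ler01)// rational_const_ge1.
      have ra : 0 <= (1 - a)^-1 by rewrite invr_ge0.
      exact: mulr_ge0 (ler0n _ 3) (addr_ge0 (mulr_ge0 (le_trans ler01 k1)
        (divr_ge0 (rc0 _ ra) a1')) (divr_ge0 (rc0 _ (lexx 0)) d0)).
    by have [] := best_constant_fin_num c0 cB.
  move=> _ e1n.
  have d30 : 0 <= 3 * d^-1 by rewrite mulr_ge0 ?invr_ge0.
  by have [] := best_constant_fin_num d30 (fun f => dB e f e1n).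
exists (fun n => 1 - d n); split.
- by move=> n _; have [/andP[d0 d1] _ _ _] := dP n; rewrite subr_gt0 d1 gtrBl.
- rewrite -[X in _ --> X]subr0; apply: cvgB; first exact: cvg_cst.
  apply: (@squeeze_cvgr _ _ _ _ (fun=> 0) (@harmonic R)).
  + by near=> n; have [/andP[/ltW-> _] dn _ _] := dP n.
  + exact: cvg_cst.
  + exact: cvg_harmonic.
move=> e e1; split; first by move=> n n0; have [_ _ + _] := dP n; apply.
(* For n >= e the sharp bound gives a quotient of at most 3 / (n d_n), and n >= 3 / eps makes this
   at most eps / d_n. *)
apply/eqoP => eps eps0; near=> n.
have n0 : (0 < n)%N by near: n; exact: nbhs_infty_gt.
have nR : 0 < n%:R :> R by rewrite ltr0n.
have [/andP[d0 d1] _ _ /(_ e n0)] := dP n.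
have -> : 1 <= e <= n%:R.
  by rewrite e1 /=; near: n; exact: nbhs_infty_ger.
move=> /(_ isT)/andP[b0 b3].
rewrite subKr !ger0_norm ?divr_ge0 ?invr_ge0 ?(ltW d0)//.
rewrite ler_pdivrMr// (le_trans b3)// mulrAC ler_wpM2r ?invr_ge0 ?(ltW d0)//.
rewrite -ler_pdivrMl// mulrC.
by near: n; exact: nbhs_infty_ger.
Unshelve. all: by end_near. Qed.
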